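(* Let $(\mathcal M,g)$ be an oriented and time-oriented Lorentzian spacetime with Poincaré groupoid $\Gamma=\mathrm{Poin}(\mathcal M,g)$, let $(\mathscr H_{\mathcal S},V)$ be a system over $\Gamma$, let $\mathcal R$ be a general relativistic quantum reference frame, let $\pi=(\pi_x:\Gamma^x\to\mathcal M)$ be a family of measurable projections that is $\mathrm{Bis}_{\mathrm{Isom}}(\Gamma)$-compatible, let $\mathfrak S_{\mathcal R}\subseteq\mathscr S(\mathscr H_{\mathcal R})$ be convex, $\sigma\ge0$, and let $\mathcal O_{\mathcal S}\subseteq\mathcal A(\mathscr H_{\mathcal S})$ be closed under adjoints and $(\mathfrak S_{\mathcal R},\sigma,\pi)$-causal. Then: 1. (Isotony) For all $\mathcal U\subseteq\mathcal V\subseteq\mathcal M$, $\mathcal A^{(\mathfrak S_{\mathcal R},\sigma,\pi)}_{\mathcal O_{\mathcal S}}(\mathcal U)\subseteq\mathcal A^{(\mathfrak S_{\mathcal R},\sigma,\pi)}_{\mathcal O_{\mathcal S}}(\mathcal V)$. 2. (Covariance) For all $b\in\mathrm{Bis}_{\mathrm{Isom}}(\Gamma)$ and all $\mathcal U\subset\mathcal M$, $\mathbf V_b\,\mathcal A^{(\mathfrak S_{\mathcal R},\sigma,\pi)}_{\mathcal O_{\mathcal S}}(\mathcal U)\,\mathbf V_b^\dagger=\mathcal A^{(b\cdot\mathfrak S_{\mathcal R},\sigma,\pi)}_{\mathcal O_{\mathcal S}}(\varphi_b(\mathcal U))$. 3. (Causality) For all $\mathcal U,\mathcal V\subset\mathcal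 M$ that are $\sigma$-locally spacelike separated, $[\mathcal A^{(\mathfrak S_{\mathcal R},\sigma,\pi)}_{\mathcal O_{\mathcal S}}(\mathcal U),\mathcal A^{(\mathfrak S_{\mathcal R},\sigma,\pi)}_{\mathcal O_{\mathcal S}}(\mathcal V)]=\{0\}$.
   Context: **Poincaré groupoid.** $\Gamma=\mathrm{Poin}(\mathcal M,g)\rightrightarrows\mathcal M$: Lie groupoid whose arrows $x\to y$ are orientation- and time-orientation-preserving linear isometries $T_x\mathcal M\to T_y\mathcal M$; $s,t$ source/target; $\Gamma^x=t^{-1}(x)$; $L_\alpha\beta=\alpha\circ\beta$. $\mu_g$: volume measure; metric signature mostly minus. A bisection $b$ is a smooth section of $s$ with $\varphi_b:=t\circ b\in\mathrm{Diff}(\mathcal M)$. $\mathrm{Bis}_{\mathrm{Isom}}(\Gamma)$: bisections $b_\varphi(x)=(d\varphi_x:T_x\mathcal M\to T_{\varphi(x)}\mathcal M)$ with $\varphi$ an orientation- and time-orientation-preserving isometry of $(\mathcal M,g)$ (so $\varphi_{b_\varphi}=\varphi$). $\pi$ is $\mathscr B$-compatible if for $\mu_g$-a.e. $x$, $\pi_{\varphi_b(x)}\circ L_{b(x)}=\varphi_b\circ\pi_x$ for all $b\in\mathscr B$. **Fields.** Hilbert spaces are complex separable. For a continuous field $\mathscr H=\bigsqcup_x\mathcal H^x$ over $\mathcal M$: $\mathcal A(\mathscr H)=\int^\oplus\mathcal B(\mathcal H^x)d\mu_g$, acting on $\mathcal H=\int^\oplus\mathcal H^xd\mu_g$; $\mathscr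 S(\mathscr H)$: fields in $\mathcal A(\mathscr H)$ that are density operators a.e. A unitary representation of $\Gamma$: measurable functorial assignment of unitaries $U_\alpha:\mathcal H^{s(\alpha)}\to\mathcal H^{t(\alpha)}$; fibre-wise ultraweakly continuous if $\alpha\mapsto\mathrm{Tr}[U_\alpha\chi_\alpha]$ is continuous for every field $\chi_\alpha\in\mathcal T(\mathcal H^{t(\alpha)},\mathcal H^{s(\alpha)})$ locally a trace-norm uniform limit of finite-rank fields $\sum_j|\xi^j_{s(\alpha)}\rangle\langle\eta^j_{t(\alpha)}|$ with $\xi^j,\eta^j$ continuous sections. A system $(\mathscr H_{\mathcal S},V)$: continuous field with such a representation. $(\mathbf V_b\Psi)_x=\big(\tfrac{d((\varphi_b)_*\mu_g)}{d\mu_g}(x)\big)^{1/2}V_{b(\varphi_b^{-1}(x))}\Psi(\varphi_b^{-1}(x))$. **Frames.** A general relativistic quantum reference frame $\mathcal R=(U,\mathsf E_{\mathcal R},\mathscr H_{\mathcal R})$: continuous field with fibre-wise ultraweakly continuous unitary representation $U$ of $\Gamma$ and normalized POVMs $\mathsf E^x_{\mathcal R}:\mathrm{Bor}(\Gamma^x)\to\mathcal E(\mathcal H^x_{\mathcal R})$, measurable in $x$, covariant ($U_\alpha\mathsf E^{s(\alpha)}_{\mathcal R}(\Delta)U_\alpha^\dagger=\mathsf E^{t(\alpha)}_{\mathcal R}(L_\alpha\Delta)$), and $\mu_g$-admissible (for $\mu_g$-a.e. $x$, $\mu_g(N)=0\Rightarrow\mathsf E^x_{\mathcal R}(s^{-1}(N)\cap\Gamma^x)=0$).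 $\mathsf F^x_{\mathcal R,\pi}(N):=\mathsf E^x_{\mathcal R}(\pi_x^{-1}(N))$; $\mu^{\mathsf E^x_{\mathcal R}}_{\omega_x}(\cdot)=\mathrm{Tr}[\omega_x\mathsf E^x_{\mathcal R}(\cdot)]$ and similarly for $\mathsf F$. $\mathrm{Loc}_\pi(\mathcal R,\omega):=\bigcup_{x\in\mathcal M}\mathrm{supp}\,\mu^{\mathsf F^x_{\mathcal R,\pi}}_{\omega_x}$. $b\cdot\mathfrak S_{\mathcal R}:=\{\omega^b\mid\omega\in\mathfrak S_{\mathcal R}\}$, $\omega^b_x=U_{b(\varphi_b^{-1}(x))}\omega_{\varphi_b^{-1}(x)}U_{b(\varphi_b^{-1}(x))}^\dagger$. **Relational field** of $\phi\in\mathcal A(\mathscr H_{\mathcal S})$: $\hat\Phi^{\mathcal R}(\omega)=\int^\oplus\hat\Phi^{\mathcal R}_x(\omega)d\mu_g(x)$, $\hat\Phi^{\mathcal R}_x(\omega)=\int_{\Gamma^x}V_\beta\phi_{s(\beta)}V_\beta^\dagger\,d\mu^{\mathsf E^x_{\mathcal R}}_{\omega_x}(\beta)$; $\hat\Psi^{\mathcal R}$ denotes the one of $\psi$. **Causality.** $CNN(\mathcal U,\mathcal V)$: pairs $(x,y)\in\mathcal U\times\mathcal V$ lying in a common geodesically convex normal neighbourhood. $\mathcal U,\mathcal V$ are $\sigma$-locally spacelike separated if $\mathcal U\subseteq\mathcal V'$ (causal complement: points not causally related to any point of $\mathcal V$) and $\sup_{(x,y)\in CNN(\mathcal U,\mathcal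 V)}g_x(\exp_x^{-1}(y),\exp_x^{-1}(y))<-\sigma$ ($\sup\varnothing=-\infty$). $\mathcal O_{\mathcal S}$ is $(\mathfrak S_{\mathcal R},\sigma,\pi)$-causal if for all $\phi,\psi\in\mathcal O_{\mathcal S}$ and $\omega^{(1)},\omega^{(2)}\in\mathfrak S_{\mathcal R}$ with $\mathrm{Loc}_\pi(\mathcal R,\omega^{(1)})$ and $\mathrm{Loc}_\pi(\mathcal R,\omega^{(2)})$ $\sigma$-locally spacelike separated, $[\hat\Phi^{\mathcal R}(\omega^{(1)}),\hat\Psi^{\mathcal R}(\omega^{(2)})]=[\hat\Phi^{\mathcal R}(\omega^{(1)})^\dagger,\hat\Psi^{\mathcal R}(\omega^{(2)})]=0$. **Relational local algebra.** $\mathcal A^{(\mathfrak S_{\mathcal R},\sigma,\pi)}_{\mathcal O_{\mathcal S}}(\mathcal U):=\{\hat\Phi^{\mathcal R}(\omega)\mid\phi\in\mathcal O_{\mathcal S},\ \omega\in\mathfrak S_{\mathcal R},\ \mathrm{Loc}_\pi(\mathcal R,\omega)\subseteq\mathcal U\}''$ (double commutant in $\mathcal B(\int^\oplus\mathcal H^x_{\mathcal S}d\mu_g)$). *)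

(* Defs.v *)
From HB Require Import structures.
From Stdlib Require Import Relations.
From mathcomp Require Import all_boot all_order all_algebra.
From mathcomp Require Import all_classical all_reals all_analysis.
From mathcomp Require Import complex.

Set Implicit Arguments.
Unset Strict Implicit.
Unset Printing Implicit Defensive.

Import Order.TTheory GRing.Theory Num.Theory.
Import numFieldTopology.Exports numFieldNormedType.Exports.

Local Open Scope classical_set_scope.
Local Open Scope ring_scope.
Local Open Scope complex_scope.

Definition choose_or {T : Type} (x0 : T) (P : T -> Prop) : T :=
  match pselect (exists x, P x) with
  | left h => projT1 (cid h)
  | right _ => x0
  end.

Notation borel T := (g_sigma_algebraType (@open T)).

Definition cmeasurable (R : realType) d (T : measurableType d) (f : T -> R[i]) :=
  measurable_fun setT (fun x => complex.Re (f x)) /\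
  measurable_fun setT (fun x => complex.Im (f x)).

Definition cintegral (R : realType) d (T : measurableType d)
    (m : {measure set T -> \bar R}) (f : T -> R[i]) : R[i] :=
  (Rintegral m setT (fun x => complex.Re (f x)))
    +i* (Rintegral m setT (fun x => complex.Im (f x))).

Definition csum (R : realType) (u : nat -> R[i]) (l : R[i]) : Prop :=
  (series (fun k => complex.Re (u k)) @ \oo --> (complex.Re l : R)) /\
  (series (fun k => complex.Im (u k)) @ \oo --> (complex.Im l : R)).

Definition ccontinuous (R : realType) (T : topologicalType) (f : T -> R[i]) :=
  continuous (fun x => complex.Re (f x) : R) /\
  continuous (fun x => complex.Im (f x) : R).

(* Only used on open sets [D]. *)
Fixpoint Ck (R : realType) (V W : normedModType R) (k : nat)
    (D : set V) (f : V -> W) : Prop :=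
  (forall p, D p -> {for p, continuous f}) /\
  match k with
  | 0 => True
  | k'.+1 => (forall p, D p -> differentiable f p) /\
      forall v : V, Ck k' D (fun p => 'D_v f p)
  end.

Definition Cinf (R : realType) (V W : normedModType R) (D : set V) (f : V -> W) :=
  forall k, Ck k D f.

Record chart (R : realType) (d : nat) (M : Type) := Chart {
  cdom : set M;
  cmap : M -> 'rV[R]_d;
  cinv : 'rV[R]_d -> M }.

Definition cimg (R : realType) d (M : Type) (c : chart R d M) : set 'rV[R]_d :=
  cmap c @` cdom c.

Definition is_chart (R : realType) d (M : topologicalType) (c : chart R d M) :=
  [/\ open (cdom c), open (cimg c),
      (forall x, cdom c x -> cinv c (cmap c x) = x),
      (forall x, cdom c x -> {for x, continuous (cmap c)}) &
      (forall p, cimg c p -> {for p, continuous (cinv c)})].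

Definition ctrans (R : realType) d (M : Type) (c c' : chart R d M)
  : 'rV[R]_d -> 'rV[R]_d := cmap c' \o cinv c.

Definition ccompat (R : realType) d (M : Type) (c c' : chart R d M) :=
  Cinf (cmap c @` (cdom c `&` cdom c')) (ctrans c c').

(* [chart_at x] is a preferred chart around [x]: the tangent space at [x] is
   modelled as the space of coordinates in that chart, T_x M := 'rV[R]_d, and
   is moved to other charts by the Jacobians of transition maps. *)
Record manifold (R : realType) (d : nat) := Manifold {
  mcar :> ptopologicalType;
  atlas : set (chart R d mcar);
  chart_at : mcar -> chart R d mcar;
  m_hausdorff : hausdorff_space mcar;
  m_countable : @second_countable mcar;
  atlas_chart : forall c, atlas c -> is_chart c;
  atlas_compat : forall c c', atlas c -> atlas c' -> ccompat c c';
  atlas_max : forall c, is_chart c ->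
    (forall c', atlas c' -> ccompat c c' /\ ccompat c' c) -> atlas c;
  atlas_at : forall x, atlas (chart_at x);
  dom_at : forall x, cdom (chart_at x) x }.

Section ManifoldTheory.
Variables (R : realType) (d : nat).
Implicit Types M N : manifold R d.

Definition smooth_into (V : normedModType R) M (D : set V) (f : V -> M) : Prop :=
  (forall p, D p -> {for p, continuous f}) /\
  forall c, atlas c -> Cinf (D `&` f @^-1` cdom c) (cmap c \o f).

Definition smooth_from (W : normedModType R) M (O : set M) (f : M -> W) : Prop :=
  forall c, atlas c -> Cinf (cmap c @` (O `&` cdom c)) (f \o cinv c).

Definition smooth_map M N (f : M -> N) : Prop :=
  forall c, atlas c -> smooth_into (cimg c) (f \o cinv c).

(* The differential T_x M -> T_(f x) N: vectors are rows and linear maps act by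
   right multiplication, as for ['J]. *)
Definition tmap M N (f : M -> N) (x : M) : 'M[R]_d :=
  'J (cmap (chart_at (f x)) \o f \o cinv (chart_at x)) (cmap (chart_at x) x).

(* Change of basis of T_x M, from the coordinates of the chart [c] to those of
   [chart_at x], and back. *)
Definition from_chart M (c : chart R d M) (x : M) : 'M[R]_d :=
  'J (ctrans c (chart_at x)) (cmap c x).

Definition to_chart M (c : chart R d M) (x : M) : 'M[R]_d :=
  'J (ctrans (chart_at x) c) (cmap (chart_at x) x).

Definition velocity M (gam : R -> M) (t : R) : 'rV[R]_d :=
  derive1 (fun s : R => cmap (chart_at (gam t)) (gam s)) t.

Definition unitv (i : 'I_d) : 'rV[R]_d := delta_mx 0 i.

Definition minkowski : 'M[R]_d :=
  \matrix_(i, j) (if i == j then if val i == 0%N then 1 else - 1 else 0).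

Definition is_lebesgue (lam : {measure set (borel 'rV[R]_d) -> \bar R}) : Prop :=
  forall a b : 'rV[R]_d, (forall i, a 0 i <= b 0 i) ->
    lam [set v : 'rV[R]_d | forall i, a 0 i <= v 0 i < b 0 i]
    = (\prod_i (b 0 i - a 0 i))%:E.

(* Matrix, in the coordinate frame of [c], of a field of bilinear forms given
   by matrices in the preferred coordinates. *)
Definition in_chart M (g : M -> 'M[R]_d) (c : chart R d M) (p : 'rV[R]_d)
  : 'M[R]_d :=
  from_chart c (cinv c p) *m g (cinv c p) *m (from_chart c (cinv c p))^T.

Definition is_volume M (g : M -> 'M[R]_d)
    (mu : {measure set (borel M) -> \bar R}) : Prop :=
  exists lam : {measure set (borel 'rV[R]_d) -> \bar R}, is_lebesgue lam /\
  forall (c : chart R d M) (A : set (borel M)), atlas c -> measurable A ->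
    A `<=` cdom c ->
    mu A = (\int[lam]_(p in (cmap c @` A : set (borel 'rV[R]_d)))
              (Num.sqrt `|\det (in_chart g c p)|)%:E)%E.

End ManifoldTheory.

(* Dimension [n.+2]; [metric x] is the Gram matrix of g_x on T_x M. *)
Record spacetime (R : realType) (n : nat) := Spacetime {
  st_mfd :> manifold R n.+2;
  metric : st_mfd -> 'M[R]_n.+2;
  metric_smooth : forall c : chart R n.+2 st_mfd, atlas c ->
    Cinf (cimg c) (in_chart metric c);
  metric_lorentz : forall x, exists2 P : 'M[R]_n.+2, P \in unitmx &
    P *m metric x *m P^T = minkowski R n.+2;
  (* [ori x] is +1 or -1 according to whether [chart_at x] is positively
     oriented at [x]. *)
  ori : st_mfd -> R;
  ori_pm1 : forall x, ori x = 1 \/ ori x = - 1;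
  ori_cont : forall x, exists2 c : chart R n.+2 st_mfd, atlas c & cdom c x /\
    forall y, cdom c y -> 0 < ori y * \det (from_chart c y);
  (* The time orientation is given by a continuous timelike vector field. *)
  tor : st_mfd -> 'rV[R]_n.+2;
  tor_cont : forall c : chart R n.+2 st_mfd, atlas c ->
    forall p, cimg c p ->
    {for p, continuous (fun q => tor (cinv c q) *m to_chart c (cinv c q))};
  tor_timelike : forall x, 0 < (tor x *m metric x *m (tor x)^T) 0 0;
  vol : {measure set (borel st_mfd) -> \bar R};
  vol_spec : is_volume metric vol }.

Section Lorentz.
Variables (R : realType) (n : nat) (M : spacetime R n).
Local Notation d := n.+2.
Local Notation TM := 'rV[R]_d.

Definition gform (x : M) (v w : TM) : R := (v *m metric x *m w^T) 0 0.

Definition future_timelike (x : M) (v : TM) : Prop :=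
  0 < gform x v v /\ 0 < gform x v (tor x).

Definition future_causal (x : M) (v : TM) : Prop :=
  [/\ v != 0, 0 <= gform x v v & 0 < gform x v (tor x)].

Definition causal_arc (p q : M) : Prop :=
  exists (a b : R) (gam : R -> M),
    [/\ a < 0, 1 < b & smooth_into `]a, b[%classic gam] /\
    (forall t, 0 <= t <= 1 -> future_causal (gam t) (velocity gam t)) /\
    gam 0 = p /\ gam 1 = q.

(* piecewise smooth future-directed causal curves, or [p = q] *)
Definition precedes : M -> M -> Prop := clos_refl_trans M causal_arc.

Definition causal_complement (V : set M) : set M :=
  [set p | forall q, V q -> ~ precedes p q /\ ~ precedes q p].

Definition christoffel (c : chart R d M) (p : TM) (k i j : 'I_d) : R :=
  2^-1 * \sum_l invmx (in_chart (@metric R n M) c p) k l *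
    ('D_(unitv R i) (fun q : TM => in_chart (@metric R n M) c q j l : R) p
     + 'D_(unitv R j) (fun q : TM => in_chart (@metric R n M) c q i l : R) p
     - 'D_(unitv R l) (fun q : TM => in_chart (@metric R n M) c q i j : R) p).

Definition geodesic (a b : R) (gam : R -> M) : Prop :=
  smooth_into `]a, b[%classic gam /\
  forall (c : chart R d M) t, atlas c -> a < t < b -> cdom c (gam t) ->
  let u k := (fun s : R => cmap c (gam s) 0 k : R) in
  forall k, derive1 (derive1 (u k)) t +
    \sum_i \sum_j christoffel c (cmap c (gam t)) k i j *
                  derive1 (u i) t * derive1 (u j) t = 0.

Definition expmap (x : M) (v : TM) (y : M) : Prop :=
  exists (a b : R) (gam : R -> M),
    [/\ a < 0, 1 < b & geodesic a b gam] /\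
    [/\ gam 0 = x, velocity gam 0 = v & gam 1 = y].

(* [e] is the diffeomorphism exp_x : W -> O, and [l] its inverse. *)
Definition normal_nbhd (O : set M) (x : M) (W : set TM) (e : TM -> M)
    (l : M -> TM) : Prop :=
  [/\ open O, O x, open W, W 0 &
      forall v (t : R), W v -> 0 <= t <= 1 -> W (t *: v)] /\
  [/\ forall v, W v -> [/\ O (e v), l (e v) = v & expmap x v (e v)],
      forall y, O y -> W (l y) /\ e (l y) = y,
      smooth_into W e & smooth_from O l].

Definition convex_normal (O : set M) : Prop :=
  open O /\
  forall x, O x -> exists (W : set TM) (e : TM -> M) (l : M -> TM), normal_nbhd O x W e l.

Definition CNN (U V : set M) : set (M * M) :=
  [set xy | [/\ U xy.1, V xy.2 &
    exists O, [/\ convex_normal O, O xy.1 & O xy.2]]].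

(* exp_x^-1 y, taken in a convex normal neighbourhood containing x and y. It
   depends on this neighbourhood when several non-nested ones contain the two
   points; all its values are then considered. *)
Definition expinv (x y : M) (v : TM) : Prop :=
  exists O W e l, [/\ convex_normal O, O y, normal_nbhd O x W e l & v = l y].

Definition loc_spacelike (sig : R) (U V : set M) : Prop :=
  U `<=` causal_complement V /\
  (ereal_sup [set r | exists x y v,
     [/\ CNN U V (x, y), expinv x y v & r = (gform x v v)%:E]]
   < (- sig)%:E)%E.

Definition poincare (x y : M) (A : 'M[R]_d) : Prop :=
  [/\ forall v w, gform y (v *m A) (w *m A) = gform x v w,
      0 < ori x * \det A * ori y &
      forall v, future_timelike x v <-> future_timelike y (v *m A)].

Record arrow (x y : M) := Arrow { amx : 'M[R]_d; _ : poincare x y amx }.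

Lemma arrowP (x y : M) (a : arrow x y) : poincare x y (amx a).
Proof. by case: a. Qed.

Lemma poincare1 (x : M) : poincare x x 1%:M.
Proof.
split => [v w||v]; rewrite ?mulmx1 //.
by rewrite det1 mulr1; case: (ori_pm1 x) => ->; rewrite ?mulr1 ?mulrNN ?mulr1.
Qed.

Lemma poincareM (x y z : M) (A B : 'M[R]_d) :
  poincare x y A -> poincare y z B -> poincare x z (A *m B).
Proof.
move=> [gA oA tA] [gB oB tB]; split => [v w||v].
- by rewrite !mulmxA gB gA.
- have := mulr_gt0 oA oB; rewrite det_mulmx.
  suff -> : ori x * \det A * ori y * (ori y * \det B * ori z)
         = ori x * (\det A * \det B) * ori z by [].
  have oy : ori y * ori y = 1.
    by case: (ori_pm1 y) => ->; rewrite ?mulrNN mulr1.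
  rewrite [LHS]mulrA [X in X * ori z = _]mulrA.
  by rewrite -(mulrA (ori x * \det A)) oy mulr1 !mulrA.
- by rewrite mulmxA; apply: iff_trans (tA v) (tB _).
Qed.

Definition aid (x : M) : arrow x x := Arrow (poincare1 x).

(* b o a; matrices multiply in the reverse order since they act on rows *)
Definition acomp (x y z : M) (b : arrow y z) (a : arrow x y) : arrow x z :=
  Arrow (poincareM (arrowP a) (arrowP b)).

Record garrow := GArrow { gsrc : M; gtgt : M; garr : arrow gsrc gtgt }.

HB.instance Definition _ := gen_eqMixin garrow.
HB.instance Definition _ := gen_choiceMixin garrow.
HB.instance Definition _ := isPointed.Build garrow (GArrow (aid point)).

(* Matrix of an arrow in the coordinate frames of the charts c and c'. *)
Definition arrow_in (c c' : chart R d M) (a : garrow) : 'M[R]_d :=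
  from_chart c (gsrc a) *m amx (garr a) *m to_chart c' (gtgt a).

Definition gball (c c' : chart R d M) (a : garrow) (e : R) : set garrow :=
  [set b | [/\ cdom c (gsrc b), cdom c' (gtgt b),
     `|cmap c (gsrc b) - cmap c (gsrc a)| < e,
     `|cmap c' (gtgt b) - cmap c' (gtgt a)| < e &
     `|arrow_in c c' b - arrow_in c c' a| < e]].

(* The manifold topology of the Lie groupoid: local coordinates of an arrow
   are those of its ends and its matrix in the coordinate frames. *)
Definition gopen : set (set garrow) :=
  [set O | forall a, O a -> forall c c' : chart R d M, atlas c -> atlas c' ->
     cdom c (gsrc a) -> cdom c' (gtgt a) ->
     exists2 e : R, 0 < e & gball c c' a e `<=` O].

Lemma gopenT : gopen setT.
Proof. by move=> a _ c c' _ _ _ _; exists 1. Qed.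

Lemma gopenI : setI_closed gopen.
Proof.
move=> A B oA oB a [Aa Ba] c c' hc hc' dc dc'.
have [e e0 eA] := oA a Aa c c' hc hc' dc dc'.
have [f f0 fB] := oB a Ba c c' hc hc' dc dc'.
exists (Num.min e f); first by rewrite lt_min e0.
move=> b [b1 b2]; rewrite !lt_min => /andP[? ?] /andP[? ?] /andP[? ?].
by split; [apply: eA|apply: fB].
Qed.

Lemma gopenU (I : Type) (f : I -> set garrow) :
  (forall i, gopen (f i)) -> gopen (\bigcup_i f i).
Proof.
move=> fo a [i _ fa] c c' hc hc' dc dc'.
have [e e0 eA] := fo i a fa c c' hc hc' dc dc'.
by exists e => // b /eA fb; exists i.
Qed.

HB.instance Definition _ := isOpenTopological.Build garrow gopenT gopenI gopenU.

(* Gamma^x, the arrows with target x, with the subspace topology *)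
Record arrows_to (x : M) := ArrowTo { src : M; arr : arrow src x }.

HB.instance Definition _ x := gen_eqMixin (arrows_to x).
HB.instance Definition _ x := gen_choiceMixin (arrows_to x).
HB.instance Definition _ x := isPointed.Build (arrows_to x) (ArrowTo (aid x)).

Definition ginc (x : M) (b : arrows_to x) : garrow := GArrow (arr b).

Definition Ltrans (x y : M) (a : arrow x y) (b : arrows_to x) : arrows_to y :=
  ArrowTo (acomp a (arr b)).

Record isom := Isom {
  ifun :> M -> M;
  iinv : M -> M;
  ifunK : cancel ifun iinv;
  iinvK : cancel iinv ifun;
  ifun_smooth : smooth_map ifun;
  iinv_smooth : smooth_map iinv;
  ifun_poincare : forall x, poincare x (ifun x) (tmap ifun x) }.

(* The elements of Bis_Isom are the bisections [bis phi]; their diffeomorphism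
   t o b is phi. *)
Definition bis (phi : isom) (x : M) : arrow x (phi x) :=
  Arrow (ifun_poincare phi x).

(* [bis phi (phi^-1 x)], with its target phi (phi^-1 x) rewritten to x *)
Definition bis_to (phi : isom) (x : M) : arrow (iinv phi x) x :=
  eq_rect _ (fun y => arrow (iinv phi x) y) (bis phi (iinv phi x)) _
          (iinvK phi x).

End Lorentz.

Notation borel_to x := (borel (initial_topology (@ginc _ _ _ x))).

Definition dot_norm (R : realType) (H : lmodType R[i])
  (f : {dot H for (@Num.conj R[i])}) (v : H) : R := Num.sqrt (complex.Re (f v v)).

Record hilbert (R : realType) := Hilbert {
  hcar :> lmodType R[i];
  hdot : {dot hcar for (@Num.conj R[i])};
  h_complete : forall u : nat -> hcar,
    (forall e : R, 0 < e -> exists N, forall i j, (N <= i)%N -> (N <= j)%N ->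
       dot_norm hdot (u i - u j) < e) ->
    exists l, forall e : R, 0 < e -> exists N, forall i, (N <= i)%N ->
       dot_norm hdot (u i - l) < e;
  h_separable : exists u : nat -> hcar,
    forall v (e : R), 0 < e -> exists k, dot_norm hdot (v - u k) < e }.

Section Hilbert.
Variable R : realType.
Implicit Types H K : hilbert R.

(* conjugate-linear in the first argument *)
Definition ip H (u v : H) : R[i] := @hdot R H v u.

Definition hnorm H (v : H) : R := dot_norm (@hdot R H) v.

Definition bounded_op H K (T : H -> K) : Prop :=
  linear T /\ exists c : R, forall v, hnorm (T v) <= c * hnorm v.

Definition is_adj H K (T : H -> K) (S : K -> H) : Prop :=
  forall u v, ip u (T v) = ip (S u) v.

Definition adj H K (T : H -> K) : K -> H :=
  choose_or (fun _ => 0) (is_adj T).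

Definition unitary H K (U : H -> K) : Prop :=
  [/\ linear U, (forall u v, ip (U u) (U v) = ip u v) &
      forall w, exists v, U v = w].

Definition pos_op H (T : H -> H) : Prop := forall v, 0 <= ip v (T v).

Definition effect H (T : H -> H) : Prop :=
  [/\ bounded_op T, pos_op T & forall v, ip v (T v) <= ip v v].

(* Orthonormal bases are padded with zeroes in finite dimension. *)
Definition onb H (e : nat -> H) : Prop :=
  [/\ forall i j, i <> j -> ip (e i) (e j) = 0,
      forall i, ip (e i) (e i) = 1 \/ e i = 0 &
      forall v, (forall i, ip (e i) v = 0) -> v = 0].

(* An operator is of trace class exactly when this sum converges, to the same
   value, for every orthonormal basis. *)
Definition is_trace H (T : H -> H) (t : R[i]) : Prop :=
  forall e, onb e -> csum (fun k => ip (e k) (T (e k))) t.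

Definition tr H (T : H -> H) : R[i] := choose_or 0 (is_trace T).

Definition density H (T : H -> H) : Prop :=
  [/\ bounded_op T, pos_op T & is_trace T 1].

Definition is_abs H K (T : H -> K) (P : H -> H) : Prop :=
  [/\ bounded_op P, pos_op P & forall v, P (P v) = adj T (T v)].

(* T is of trace class and Tr |T| <= c. *)
Definition trnorm_le H K (T : H -> K) (c : R) : Prop :=
  bounded_op T /\ exists P t, [/\ is_abs T P, is_trace P t & complex.Re t <= c].

Definition ketbra H K (xi : K) (eta : H) : H -> K := fun v => ip eta v *: xi.

Definition commutator H (A B : H -> H) : H -> H := fun v => A (B v) - B (A v).

Definition commutant H (S : set (H -> H)) : set (H -> H) :=
  [set T | bounded_op T /\ forall A, S A -> A \o T = T \o A].

End Hilbert.

(* Continuous fields are given by their continuous sections [csec]. The countable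
   total family of [csec_total] is the separability needed for direct integrals
   to be separable Hilbert spaces. *)
Record cfield (R : realType) (n : nat) (M : spacetime R n) := CField {
  fib :> M -> hilbert R;
  csec : set (forall x, fib x);
  csec0 : csec (fun x => 0);
  csec_lin : forall (a : R[i]) xi eta, csec xi -> csec eta ->
    csec (fun x => a *: xi x + eta x);
  csec_norm : forall xi, csec xi ->
    continuous (fun x => hnorm (xi x) : R);
  csec_closed : forall xi : (forall x, fib x),
    (forall x (e : R), 0 < e -> exists eta O,
       [/\ csec eta, open O, O x & forall y, O y -> hnorm (xi y - eta y) <= e]) ->
    csec xi;
  csec_total : exists s : nat -> forall x, fib x, (forall k, csec (s k)) /\
    forall x (v : fib x), (forall k, ip (s k x) v = 0) -> v = 0 }.

Section Fields.
Variables (R : realType) (n : nat) (M : spacetime R n).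
Implicit Types F : cfield M.
Local Notation mu := (vol M).

Definition section F := forall x, F x.
Definition opfield F := forall x, F x -> F x.

Definition ae_sec F (xi eta : section F) : Prop := {ae mu, forall x, xi x = eta x}.
Definition ae_op F (S T : opfield F) : Prop := {ae mu, forall x, S x = T x}.

Definition msec F (xi : section F) : Prop :=
  forall eta, csec eta -> cmeasurable (fun x : borel M => ip (eta x) (xi x)).

Definition L2sec F (xi : section F) : Prop :=
  msec xi /\ (\int[mu]_x (hnorm (xi x) ^+ 2)%:E < +oo)%E.

(* A realization of the direct integral Hilbert space: the space of square
   integrable sections modulo equality almost everywhere, [dcls] being the
   class of a section. It is unique up to a unique unitary compatible with
   [dcls], and [dcls_ip] implies that L^2 sections are identified by [dcls]
   exactly when they are equal almost everywhere. *)
Record dintegral F := DIntegral {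
  dspace :> hilbert R;
  dcls : section F -> dspace;
  dcls_lin : forall (a : R[i]) xi eta, L2sec xi -> L2sec eta ->
    dcls (fun x => a *: xi x + eta x) = a *: dcls xi + dcls eta;
  dcls_ip : forall xi eta, L2sec xi -> L2sec eta ->
    ip (dcls xi) (dcls eta) = cintegral mu (fun x => ip (xi x) (eta x));
  dcls_surj : forall v, exists2 xi, L2sec xi & dcls xi = v }.

(* W maps the class of xi to that of w xi; an auxiliary eta is needed because
   [msec] is Borel measurability, which is not stable under a.e. equality. *)
Definition acts_as F (K : dintegral F) (w : section F -> section F)
    (W : K -> K) : Prop :=
  bounded_op W /\
  forall xi, L2sec xi -> exists2 eta, L2sec eta &
    ae_sec eta (w xi) /\ W (dcls K xi) = dcls K eta.

Definition lift_op F (K : dintegral F) (w : section F -> section F) : K -> K :=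
  choose_or (fun _ => 0) (@acts_as F K w).

Definition decomposable F (K : dintegral F) (T : opfield F) : K -> K :=
  lift_op (fun xi x => T x (xi x)).

(* Fields representing the elements of A(F); the latter are their classes for
   [ae_op]. *)
Definition A_field F : set (opfield F) :=
  [set T | [/\ forall x, bounded_op (T x),
     forall xi, msec xi -> msec (fun x => T x (xi x)) &
     exists c : R, {ae mu, forall x, forall v, hnorm (T x v) <= c * hnorm v}]].

Definition state_field F : set (opfield F) :=
  [set T | A_field T /\ {ae mu, forall x, density (T x)}].

(* A subset of the quotient of [X] by [ae_op] is a saturated subset of [X]. *)
Definition subset_ae F (S X : set (opfield F)) : Prop :=
  S `<=` X /\ forall S0 T, S S0 -> X T -> ae_op S0 T -> S T.

Definition convex_fields F (S : set (opfield F)) : Prop :=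
  forall (t : R) S0 S1, S S0 -> S S1 -> 0 <= t <= 1 ->
    S (fun x v => t%:C *: S0 x v + (1 - t)%:C *: S1 x v).

Definition adj_closed F (S : set (opfield F)) : Prop :=
  forall T, S T -> S (fun x => adj (T x)).

(* Fields chi_a in the trace class T(F_(t a), F_(s a)) that are locally
   trace-norm uniform limits of finite rank fields *)
Definition tcfield F (chi : forall a : garrow M, F (gtgt a) -> F (gsrc a)) : Prop :=
  (forall a, exists c, trnorm_le (chi a) c) /\
  forall a0, exists O : set (garrow M), [/\ open O, O a0 &
    forall e : R, 0 < e ->
    exists (k : nat) (xi eta : 'I_k -> section F),
      (forall j, csec (xi j) /\ csec (eta j)) /\
      forall a, O a -> trnorm_le (fun v => chi a v -
        \sum_(j < k) ketbra (xi j (gsrc a)) (eta j (gtgt a)) v) e].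

Record urep F := URep {
  rep :> forall x y, arrow x y -> F x -> F y;
  rep_unitary : forall x y (a : arrow x y), unitary (rep a);
  rep_id : forall x v, rep (aid x) v = v;
  rep_comp : forall x y z (b : arrow y z) (a : arrow x y) v,
    rep (acomp b a) v = rep b (rep a v);
  rep_meas : forall xi eta, msec xi -> msec eta ->
    cmeasurable (fun a : borel (garrow M) =>
      ip (eta (gtgt a)) (rep (garr a) (xi (gsrc a))));
  rep_uwcont : forall chi, tcfield chi ->
    ccontinuous (fun a => tr (fun v => rep (garr a) (chi a v))) }.

Definition push_op F (U : urep F) (phi : isom M) (w : opfield F) : opfield F :=
  fun x v => U _ _ (bis_to phi x) (w _ (adj (U _ _ (bis_to phi x)) v)).

Definition push_set F (U : urep F) (phi : isom M) (S : set (opfield F)) :=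
  [set push_op U phi w | w in S].

(* the density d (phi_* mu) / d mu *)
Definition volRN (phi : isom M) : M -> R :=
  choose_or (fun _ => 0) (fun f : M -> R =>
    [/\ measurable_fun setT (f : borel M -> R), forall x, 0 <= f x &
    forall A : set (borel M), measurable A ->
      mu ((phi : M -> M) @^-1` A) = (\int[mu]_(x in A) (f x)%:E)%E]).

Definition bigV F (K : dintegral F) (V : urep F) (phi : isom M) : K -> K :=
  lift_op (fun Psi x =>
    (Num.sqrt (volRN phi x))%:C *: V _ _ (bis_to phi x) (Psi (iinv phi x))).

Record qframe := QFrame {
  qf_field :> cfield M;
  qf_rep : urep qf_field;
  povm : forall x, set (borel_to x) -> qf_field x -> qf_field x;
  povm_effect : forall x (D : set (borel_to x)), measurable D -> effect (povm D);
  povm_setT : forall x v, povm (setT : set (borel_to x)) v = v;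
  povm_sigma : forall x (D : nat -> set (borel_to x)),
    (forall k, measurable (D k)) -> trivIset setT D ->
    forall u v, csum (fun k => ip u (povm (D k) v)) (ip u (povm (\bigcup_k D k) v));
  povm_meas : forall D : set (borel (garrow M)), measurable D ->
    forall xi eta, msec xi -> msec eta ->
    cmeasurable (fun x : borel M =>
      ip (xi x) (povm (@ginc R n M x @^-1` D : set (borel_to x)) (eta x)));
  povm_cov : forall x y (a : arrow x y) (D : set (borel_to x)), measurable D ->
    forall v, qf_rep _ _ a (povm D (adj (qf_rep _ _ a) v))
              = povm (Ltrans a @` D : set (borel_to y)) v;
  povm_adm : {ae mu, forall x, forall N : set (borel M), measurable N ->
    mu N = 0%E -> forall v,
    povm ((@src R n M x) @^-1` N : set (borel_to x)) v = 0} }.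

Definition projections := forall x : M, arrows_to x -> M.

Definition proj_measurable (pi : projections) : Prop :=
  forall x, measurable_fun setT (pi x : borel_to x -> borel M).

Definition isom_compatible (pi : projections) : Prop :=
  {ae mu, forall x, forall phi : isom M,
    pi (phi x) \o Ltrans (bis phi x) = phi \o pi x}.

Section Frame.
Variables (Q : qframe) (pi : projections).

(* The measure D |-> Tr[w E^x(D)] on Gamma^x; its values on Borel sets are
   determined, and it is the zero measure when [w] is such that this formula
   does not define a measure (on a null set of [x] for a field of states). *)
Definition frame_measure (x : M) (w : Q x -> Q x)
  : {measure set (borel_to x) -> \bar R} :=
  choose_or (mzero : {measure set (borel_to x) -> \bar R})
    (fun m : {measure set (borel_to x) -> \bar R} =>
      forall D : set (borel_to x), measurable D -> exists2 r : R, m D = r%:E &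
        tr (w \o povm D) = r%:C).

Definition povmF (x : M) (N : set M) : Q x -> Q x :=
  povm (@pi x @^-1` N : set (borel_to x)).

(* the support of Tr[w F^x(.)] *)
Definition supp_povmF (x : M) (w : Q x -> Q x) : set M :=
  [set p | forall O, open O -> O p -> tr (w \o povmF O) != 0].

Definition Loc (w : opfield Q) : set M := \bigcup_x supp_povmF (w x).

Variables (F : cfield M) (K : dintegral F) (V : urep F).

(* \int_(Gamma^x) V_b phi_(s b) V_b^dagger d Tr[w_x E^x(b)], as a weak integral *)
Definition rel_fibre (phi : opfield F) (w : opfield Q) : opfield F := fun x =>
  choose_or (fun _ => 0) (fun T : F x -> F x => bounded_op T /\
    forall u v, ip u (T v) = cintegral (frame_measure (w x))
      (fun b => ip u (V _ _ (arr b) (phi _ (adj (V _ _ (arr b)) v))))).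

Definition rel_field (phi : opfield F) (w : opfield Q) : K -> K :=
  decomposable (rel_fibre phi w).

Definition causal_fields (S : set (opfield Q)) (sig : R) (OS : set (opfield F)) :=
  forall phi psi w1 w2, OS phi -> OS psi -> S w1 -> S w2 ->
    loc_spacelike sig (Loc w1) (Loc w2) ->
    commutator (rel_field phi w1) (rel_field psi w2) = (fun _ => 0) /\
    commutator (adj (rel_field phi w1)) (rel_field psi w2) = (fun _ => 0).

(* sigma only enters the causality assumption, not the definition of the
   algebra. The states [w] range over all representatives of the classes in
   [S], and the condition on [Loc] is on the representative. *)
Definition local_algebra (S : set (opfield Q)) (OS : set (opfield F))
    (U : set M) : set (K -> K) :=
  commutant (commutant [set T | exists phi w,
    [/\ OS phi, S w, Loc w `<=` U & T = rel_field phi w]]).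

End Frame.

End Fields.

Arguments bigV {R n M F} K V phi.
Arguments local_algebra {R n M Q} pi {F} K V S OS U.
Arguments causal_fields {R n M Q} pi {F} K V S sig OS.

(* Main.v *)
Require Import Defs.
From mathcomp Require Import all_boot all_order all_algebra.
From mathcomp Require Import all_classical all_reals all_analysis measurable_realfun.
From mathcomp Require Import complex perm ring lra.

Set Implicit Arguments.
Unset Strict Implicit.
Unset Printing Implicit Defensive.

Import Order.TTheory GRing.Theory Num.Theory.
Import numFieldTopology.Exports numFieldNormedType.Exports.

Local Open Scope classical_set_scope.
Local Open Scope ring_scope.
Local Open Scope complex_scope.

(* An isometry phi carries a chart c to c o phi^-1, which is again in the maximal
   atlas. Read in these two charts, phi is the identity and its differential is
   the identity matrix. Hence phi preserves the volume without any change of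
   variables, its Radon-Nikodym density is 1 almost everywhere, and left
   translation by d(phi) is a homeomorphism of the groupoid. So V_b is unitary,
   and covariance of the POVM with functoriality of V gives
   Phi_(phi x)(w^b) = V_(b x) Phi_x(w) V_(b x)^*, i.e. conjugation by V_b maps the
   generators of one local algebra onto those of the other; bicommutants follow.
   Causality is algebraic: if S is contained in T', then T'' is contained in S',
   which commutes with S''. Wherever a definition selects an object that may
   fail to exist, existence itself is transported along phi, so both sides
   receive the same default value. *)

(* [iinv] of [fintype] shadows the inverse of an isometry. *)
Local Notation iinv := Defs.iinv.

(** * Integrals of arbitrary functions *)

(* The integral of a nonnegative function is a supremum over the simple
   functions below it. The lemmas here hold without measurability, which is not
   available for the integrands [ip (xi x) (eta x)] of two weakly measurable
   sections, nor for those of the relational fields. *)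
Section ArbitraryIntegrals.
Local Open Scope ereal_scope.
Context d (T : measurableType d) (R : realType) (mu : {measure set T -> \bar R}).
Implicit Types f g : T -> \bar R.

Import HBNNSimple.

Lemma le_integral_arbitrary f g : (forall x, 0 <= f x) ->
  (forall x, f x <= g x) -> \int[mu]_x f x <= \int[mu]_x g x.
Proof.
move=> f0 fg; have g0 x : 0 <= g x by exact: le_trans (fg x).
rewrite !ge0_integralTE//; apply: ereal_sup_le => _ [h /= hf <-].
by exists h => //= x; apply: le_trans (fg x).
Qed.

(** A simple function below [f] can be set to zero on the exceptional null set [Z]. Its integral is
    unchanged and it then lies below [g] everywhere. *)
Lemma ae_le_integral_arbitrary f g : (forall x, 0 <= f x) -> (forall x, 0 <= g x) ->
  {ae mu, forall x, f x = g x} -> \int[mu]_x f x <= \int[mu]_x g x.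
Proof.
move=> f0 g0 [Z [mZ Z0 sZ]].
rewrite [leLHS]ge0_integralTE//; apply: ge_ereal_sup => _ [h /= hf <-].
have := integral_nnsfun mu measurableT h; rewrite patch_setT => <-.
have hm : measurable_fun setT (fun x => (h x)%:E) by exact/measurable_EFinP.
rewrite (@ge0_negligible_integral _ _ _ mu setT Z (fun x => (h x)%:E)) //=; last first.
  by move=> x _; rewrite lee_fin; exact: fun_ge0.
rewrite integral_mkcond; apply: le_integral_arbitrary => x.
  by rewrite patchE; case: ifP => // _; rewrite lee_fin; exact: fun_ge0.
rewrite patchE; case: ifPn => [/set_mem [_ Zx]|//].
rewrite (le_trans (hf x))//; have [->//|nfg] := pselect (f x = g x).
by exfalso; apply: Zx; apply: sZ.
Qed.

Lemma ae_eq_integral_arbitrary f g : {ae mu, forall x, f x = g x} ->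
  \int[mu]_x f x = \int[mu]_x g x.
Proof.
move=> fg; rewrite integralE [RHS]integralE.
by congr (_ - _); apply/eqP; rewrite eq_le;
  apply/andP; split; apply: ae_le_integral_arbitrary => //;
  apply: filterS fg => x /= fgx; rewrite ?funeposE ?funenegE fgx.
Qed.

End ArbitraryIntegrals.

Section Transfer.
Local Open Scope ereal_scope.
Context d1 d2 (T1 : measurableType d1) (T2 : measurableType d2) (R : realType).
Variables (m1 : {measure set T1 -> \bar R}) (m2 : {measure set T2 -> \bar R}).
Variables (h : T1 -> T2) (k : T2 -> T1).
Hypotheses (mh : measurable_fun setT h) (hk : cancel k h).
Hypothesis m12 : forall A, measurable A -> m2 A = m1 (h @^-1` A).

Import HBNNSimple.

(** The pushforward formula is applied only to the simple functions below [f], whose composites with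
    [h] lie below [f \o h]. A simple function below [f \o h] need not factor through [h], hence a
    mere inequality; the converse comes from the inverse map. *)
Lemma le_integral_transfer (f : T2 -> \bar R) : (forall x, 0 <= f x) ->
  \int[m2]_y f y <= \int[m1]_x f (h x).
Proof.
move=> f0.
rewrite [leLHS]ge0_integralTE//; apply: ge_ereal_sup => _ [s /= sf <-].
have := integral_nnsfun m2 measurableT s; rewrite patch_setT => <-.
have sm : measurable_fun setT (fun x => (s x)%:E) by exact/measurable_EFinP.
rewrite (@eq_measure_integral _ _ _ _ (pushforward m1 h)); last first.
  by move=> A mA _; rewrite m12.
rewrite (ge0_integral_pushforward mh) ?preimage_setT//; last first.
  by move=> y _; rewrite lee_fin; exact: fun_ge0.
apply: le_integral_arbitrary => x /=; last exact: sf.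
by rewrite lee_fin; exact: fun_ge0.
Qed.

End Transfer.

Section TransferEq.
Context d1 d2 (T1 : measurableType d1) (T2 : measurableType d2) (R : realType).
Variables (m1 : {measure set T1 -> \bar R}) (m2 : {measure set T2 -> \bar R}).
Variables (h : T1 -> T2) (k : T2 -> T1).
Hypotheses (mh : measurable_fun setT h) (mk : measurable_fun setT k).
Hypotheses (hk : cancel k h) (kh : cancel h k).
Hypothesis m12 : forall A, measurable A -> m2 A = m1 (h @^-1` A).

Let m21 A : measurable A -> m1 A = m2 (k @^-1` A).
Proof.
move=> mA; rewrite m12; last by rewrite -[X in measurable X]setTI; exact: mk.
by rewrite -comp_preimage; congr (m1 _); apply/seteqP; split => x /=; rewrite kh.
Qed.

Lemma integral_transfer (f : T2 -> \bar R) :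
  (\int[m2]_y f y = \int[m1]_x f (h x))%E.
Proof.
have pos (g : T2 -> \bar R) : (forall x, 0 <= g x)%E ->
    (\int[m2]_y g y = \int[m1]_x g (h x))%E.
  move=> g0; apply/eqP; rewrite eq_le; apply/andP; split.
    exact: le_integral_transfer.
  have := @le_integral_transfer _ _ _ _ _ m2 m1 k mk m21 (g \o h) (fun x => g0 (h x)).
  by congr (_ <= _)%E; apply: eq_integral => y _ /=; rewrite hk.
rewrite integralE [RHS]integralE.
rewrite (pos _ (funepos_ge0 f)) (pos _ (funeneg_ge0 f)).
by congr (_ - _)%E; apply: eq_integral => x _; rewrite ?funeposE ?funenegE.
Qed.

Lemma cintegral_transfer (f : T2 -> R[i]) : cintegral m2 f = cintegral m1 (f \o h).
Proof.
rewrite /cintegral /Rintegral; congr (fine _ +i* fine _).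
  exact: (integral_transfer (fun x => (complex.Re (f x))%:E)).
exact: (integral_transfer (fun x => (complex.Im (f x))%:E)).
Qed.

End TransferEq.

Lemma ae_eq_cintegral d (T : measurableType d) (R : realType)
    (mu : {measure set T -> \bar R}) (f g : T -> R[i]) :
  {ae mu, forall x, f x = g x} -> cintegral mu f = cintegral mu g.
Proof.
by move=> fg; rewrite /cintegral /Rintegral; congr (fine _ +i* fine _);
  apply: ae_eq_integral_arbitrary; apply: filterS fg => x ->.
Qed.

(** * Charts, isometries and the volume *)

Section Calculus.
Variable R : realType.

Lemma near_eq_diff (V W : normedModType R) (f g : V -> W) (p : V) :
  (\near p, f p = g p) -> differentiable f p ->
  differentiable g p /\ 'd g p = 'd f p :> (V -> W).
Proof.
move=> fg df.
have fgp : f p = g p by exact: nbhs_singleton fg.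
(* The differential is characterized by the first-order expansion, which depends only on the germ at
   [p]. *)
have key : g \o shift p = cst (g p) + 'd f p +o_ 0 id.
  apply/eqaddoP => e e0.
  have /eqaddoP/(_ e e0) := diff_locally df.
  have fg0 : \forall h \near (0 : V), f (h + p) = g (h + p).
    have := fg; rewrite [X in X -> _](near_shift 0) subr0 => fg0.
    by apply: filterS fg0 => h.
  move=> Hf; apply: filterS2 fg0 Hf => h hfg.
  by rewrite /= -fgp !fctE /= hfg.
have cdf := diff_continuous df.
have dg := diff_unique cdf key.
by split => //; apply/diff_locallyP; rewrite dg.
Qed.

(** Agreement of [h] with the composite is asked only near [p]: coordinate expressions compose only
    where the intermediate chart is defined. The factors are in this order because vectors are
    rows. *)
Lemma jacobian_comp (a b c : nat) (f : 'rV[R]_a -> 'rV[R]_b)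
    (g : 'rV[R]_b -> 'rV[R]_c) (h : 'rV[R]_a -> 'rV[R]_c) p :
  differentiable f p -> differentiable g (f p) ->
  (\near p, h p = g (f p)) -> 'J h p = 'J f p *m 'J g (f p).
Proof.
move=> df dg hgf.
have dgf := differentiable_comp df dg.
have /near_eq_diff/(_ dgf) [_ dh] : \near p, (g \o f) p = h p.
  by apply: filterS hgf => q ->.
apply/row_matrixP => i; rewrite row_mul !rowE /jacobian !mul_rV_lin1 dh.
by rewrite (diff_comp df dg).
Qed.

Lemma jacobian_near_id (a : nat) (f : 'rV[R]_a -> 'rV[R]_a) p :
  (\near p, f p = p) -> 'J f p = 1%:M.
Proof.
move=> fid.
have did : is_diff p (@idfun 'rV[R]_a) idfun by exact: is_diff_id.
have /near_eq_diff/(_ (ex_diff (is_diff_def := did))) [_ df] : \near p, idfun p = f p.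
  by apply: filterS fid => q ->.
apply/row_matrixP => i; rewrite !rowE /jacobian mul_rV_lin1 df mulmx1.
by rewrite (diff_val (is_diff_def := did)).
Qed.

Lemma bilinear_mx_inj (a : nat) (A B : 'M[R]_a) :
  (forall v w : 'rV[R]_a, (v *m A *m w^T) 0 0 = (v *m B *m w^T) 0 0) -> A = B.
Proof.
have E (C : 'M[R]_a) i j : C i j = 
      ((delta_mx 0 i : 'rV[R]_a) *m C *m (delta_mx 0 j : 'rV[R]_a)^T) 0 0.
  by rewrite -rowE trmx_delta -colE !mxE.
by move=> AB; apply/matrixP => i j; rewrite !E AB.
Qed.

End Calculus.

(** Lindelöf property: the members of a countable base that satisfy [P] already cover. [C k] is the
    base member with code [k] when it satisfies [P], and is empty otherwise, whence [P set0]. *)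
Lemma second_countable_cover (T : topologicalType) (P : set T -> Prop) :
  @second_countable T -> P set0 -> (forall A B, A `<=` B -> P B -> P A) ->
  (forall x, exists O, [/\ open O, O x & P O]) ->
  exists C : nat -> set T,
    [/\ forall k, open (C k), forall k, P (C k) & \bigcup_k C k = setT].
Proof.
move=> [B cB [Bo Bb]] P0 Psub Pcov.
have [f finj] := elimT (countable_injP _) cB.
pose Q k A := [/\ B A, P A & f A = k].
pose C k := choose_or set0 (Q k).
have CP k : C k = set0 \/ Q k (C k).
  by rewrite /C /choose_or; case: pselect => [h|_]; [right; case: cid|left].
exists C; split => [k|k|].
- by case: (CP k) => [->|[/Bo]//]; exact: open0.
- by case: (CP k) => [->|[]].
- apply/seteqP; split => // x _.
  have [U [oU Ux PU]] := Pcov x.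
  have [A [BA Ax] AU] := Bb x U (open_nbhs_nbhs (conj oU Ux)).
  have QA : Q (f A) A by split => //; exact: Psub PU.
  exists (f A) => //; have -> // : C (f A) = A.
  rewrite /C /choose_or; case: pselect => [h|[]]; last by exists A.
  by case: cid => A' [BA' PA' fA] /=; apply: finj => //; rewrite inE.
Qed.

Section ManifoldMaps.
Variables (R : realType) (d : nat) (M : manifold R d).
Implicit Types (c : chart R d M) (f g : M -> M).

Lemma Cinf_differentiable (V W : normedModType R) (D : set V) (f : V -> W) p :
  Cinf D f -> D p -> differentiable f p.
Proof. by move=> /(_ 1%N) [_ [df _]] /df. Qed.

Lemma cdom_nbhs c x : atlas c -> cdom c x -> nbhs x (cdom c).
Proof. by move=> /atlas_chart [oc *]; apply: open_nbhs_nbhs. Qed.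

Lemma cinv_nbhs c x (A : set M) : atlas c -> cdom c x -> nbhs x A ->
  nbhs (cmap c x) (cinv c @^-1` A).
Proof.
move=> ac cx nA; have [_ _ K _ ci] := atlas_chart ac.
have /ci : cimg c (cmap c x) by exists x.
by rewrite /prop_for /continuous_at K//; apply.
Qed.

Lemma smooth_map_continuous f : smooth_map f -> continuous f.
Proof.
move=> sf x; have ac := @atlas_at _ _ M x; have cx := @dom_at _ _ M x.
set c := chart_at x in ac cx.
have [oc _ K cm _] := atlas_chart ac.
have [cf _] := sf c ac.
have fx : f x = (f \o cinv c) (cmap c x) by rewrite /= K.
rewrite /continuous_at fx; apply: cvg_trans (continuous_comp (cm _ cx) (cf _ _)); last first.
  by exists x.
apply: near_eq_cvg.
by near=> y; rewrite /= K//; near: y; exact: cdom_nbhs.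
Unshelve. all: by end_near. Qed.

(** This is compatibility of the atlas. It makes transition maps coordinate expressions of a smooth
    map, so that the chain rule for smooth maps covers them. *)
Lemma smooth_map_id : smooth_map (idfun : M -> M).
Proof.
move=> c ac; have [oc oi K cm ci] := atlas_chart ac; split => // c' ac'.
have := atlas_compat ac ac'; rewrite /ccompat (_ : _ @` _ =
  cimg c `&` (idfun \o cinv c) @^-1` cdom c') //.
apply/seteqP; split => [_ [x [cx cx'] <-]|_ [[x cx <-]]]; rewrite /= K//.
by split => //; exists x.
by move=> cx'; exists x.
Qed.

Definition local_rep f c c' : 'rV[R]_d -> 'rV[R]_d := cmap c' \o f \o cinv c.

Lemma local_rep_differentiable f c c' x : smooth_map f -> atlas c -> atlas c' ->
  cdom c x -> cdom c' (f x) -> differentiable (local_rep f c c') (cmap c x).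
Proof.
move=> sf ac ac' cx cfx; have [_ _ K _ _] := atlas_chart ac.
have [_ /(_ c' ac') s] := sf c ac.
by apply: (Cinf_differentiable s); split; [exists x|rewrite /= K].
Qed.

(** [from_chart] and [to_chart] are Jacobians of local representatives of the identity, and [tmap]
    is one for the map itself. The relations between these matrices are all instances of this chain
    rule. *)
Lemma jacobian_local_rep f g c c' c'' x : smooth_map f -> smooth_map g ->
  atlas c -> atlas c' -> atlas c'' ->
  cdom c x -> cdom c' (f x) -> cdom c'' (g (f x)) ->
  'J (local_rep (g \o f) c c'') (cmap c x) =
  'J (local_rep f c c') (cmap c x) *m 'J (local_rep g c' c'') (cmap c' (f x)).
Proof.
move=> sf sg ac ac' ac'' cx cfx cgfx; have [_ _ K _ _] := atlas_chart ac.
have [_ _ K' _ _] := atlas_chart ac'.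
have fE : local_rep f c c' (cmap c x) = cmap c' (f x) by rewrite /local_rep /= K.
rewrite -fE; apply: jacobian_comp.
- exact: local_rep_differentiable.
- by rewrite fE; exact: local_rep_differentiable.
- have := cinv_nbhs ac cx (smooth_map_continuous sf (cdom_nbhs ac' cfx)).
  by apply: filterS => p /= cp; rewrite /local_rep /= K'.
Qed.

Lemma from_chartK c x : atlas c -> cdom c x ->
  from_chart c x *m to_chart c x = 1%:M.
Proof.
move=> ac cx; have ax := @atlas_at _ _ M x; have dx := @dom_at _ _ M x.
have := jacobian_local_rep smooth_map_id smooth_map_id ac ax ac cx dx cx.
rewrite /from_chart /to_chart => <-; apply: jacobian_near_id.
have [_ oi K _ _] := atlas_chart ac.
have : nbhs (cmap c x) (cimg c) by apply: open_nbhs_nbhs; split => //; exists x.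
by apply: filterS => _ [y cy <-]; rewrite /local_rep /= K.
Qed.

End ManifoldMaps.

Section IsomCharts.
Variables (R : realType) (n : nat) (M : spacetime R n) (phi : isom M).
Local Notation d := n.+2.

Lemma isom_continuous : continuous (phi : M -> M).
Proof. exact: smooth_map_continuous (ifun_smooth phi). Qed.

Lemma iinv_continuous : continuous (iinv phi).
Proof. exact: smooth_map_continuous (iinv_smooth phi). Qed.

(* Reading the spacetime in the transported chart around [phi y] is reading it
   in [c] around [y]: this replaces every change of variables below. *)
Definition push_chart (c : chart R d M) : chart R d M :=
  Chart (iinv phi @^-1` cdom c) (cmap c \o iinv phi) (phi \o cinv c).

Lemma push_chart_cimg c : cimg (push_chart c) = cimg c.
Proof.
apply/seteqP; split => _ [x /= cx <-]; first by exists (iinv phi x).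
by exists (phi x); rewrite /= ifunK.
Qed.

Lemma push_chart_is_chart c : is_chart c -> is_chart (push_chart c).
Proof.
move=> [oc oi K cm ci]; split.
- by apply: open_comp => // x _; exact: iinv_continuous.
- by rewrite push_chart_cimg.
- by move=> x cx; rewrite /= K// iinvK.
- by move=> x cx; apply: continuous_comp; [exact: iinv_continuous|exact: cm].
- move=> p; rewrite push_chart_cimg => cp.
  by apply: continuous_comp; [exact: ci|exact: isom_continuous].
Qed.

(** By maximality of the atlas: the transitions between the transported chart and [c'] are the
    expressions of [phi] and of its inverse in [c] and [c'], which are smooth. *)
Lemma push_chart_atlas c : atlas c -> atlas (push_chart c).
Proof.
move=> ac; have cc := atlas_chart ac; apply: atlas_max.
  exact: push_chart_is_chart.
move=> c' ac'; have [_ _ K _ _] := cc; have [_ _ K' _ _] := atlas_chart ac'.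
split.
- have [_ /(_ c' ac')] := ifun_smooth phi ac; rewrite /ccompat.
  congr Cinf; apply/seteqP; split => [_ [[x cx <-] /=]|_ [x [/= cx cx'] <-]].
    by rewrite K// => cx'; exists (phi x); rewrite /= ifunK.
  by split; [exists (iinv phi x)|rewrite /= K// iinvK].
- have [_ /(_ c ac)] := iinv_smooth phi ac'; rewrite /ccompat.
  congr Cinf; apply/seteqP; split => [_ [[x cx <-] /=]|_ [x [/= cx' cx] <-]].
    by rewrite K'// => cx'; exists x.
  by split; [exists x|rewrite /= K'].
Qed.

Lemma from_push_chart c y : atlas c -> cdom c y ->
  from_chart (push_chart c) (phi y) = from_chart c y *m tmap phi y.
Proof.
move=> ac cy; have ay := @atlas_at _ _ M y; have dy := @dom_at _ _ M y.
have := jacobian_local_rep (@smooth_map_id _ _ M) (ifun_smooth phi) ac ay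
  (@atlas_at _ _ M (phi y)) cy dy (@dom_at _ _ M (phi y)).
by rewrite /from_chart /= ifunK => <-.
Qed.

Lemma to_push_chart c y : atlas c -> cdom c y ->
  tmap phi y *m to_chart (push_chart c) (phi y) = to_chart c y.
Proof.
move=> ac cy; have ay := @atlas_at _ _ M y; have dy := @dom_at _ _ M y.
have ciy : cdom c (iinv phi (phi y)) by rewrite ifunK.
have := jacobian_local_rep (ifun_smooth phi) (iinv_smooth phi) ay
  (@atlas_at _ _ M (phi y)) ac dy (@dom_at _ _ M (phi y)) ciy.
rewrite (_ : iinv phi \o phi = id); last by apply/funext => x; exact: ifunK.
by move=> <-.
Qed.

Lemma bis_in_push_chart c y : atlas c -> cdom c y ->
  from_chart c y *m tmap phi y *m to_chart (push_chart c) (phi y) = 1%:M.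
Proof.
move=> ac cy; rewrite -mulmxA.
by apply: etrans (congr1 (mulmx _) (to_push_chart ac cy)) _; exact: from_chartK.
Qed.

Lemma tmap_metric y :
  tmap phi y *m metric (phi y) *m (tmap phi y)^T = metric y.
Proof.
have [gp _ _] := ifun_poincare phi y.
apply: bilinear_mx_inj => v w; have := gp v w.
by rewrite /gform trmx_mul !mulmxA.
Qed.

Lemma in_push_chart c p : atlas c -> cimg c p ->
  in_chart (@metric R n M) (push_chart c) p = in_chart (@metric R n M) c p.
Proof.
move=> ac [y cy <-]; have [_ _ K _ _] := atlas_chart ac.
rewrite /in_chart /= (K _ cy) (from_push_chart ac cy) -(tmap_metric y).
move: (from_chart c y) (tmap phi y) => A B.
by rewrite trmx_mul !mulmxA.
Qed.

End IsomCharts.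

Section Volume.
Variables (R : realType) (n : nat) (M : spacetime R n).
Local Notation d := n.+2.
Local Notation mu := (vol M).

Lemma open_measurable_borel (T : ptopologicalType) (A : set T) : open A ->
  measurable (A : set (borel T)).
Proof. by move=> oA; exact: sub_sigma_algebra. Qed.

Lemma continuous_measurable_borel (S T : ptopologicalType) (f : S -> T) :
  continuous f -> measurable_fun setT (f : borel S -> borel T).
Proof.
move=> cf; apply: (@measurability _ _ _ (borel T) _ _ (@open T)) => // _ [A oA <-].
by rewrite setTI; apply: open_measurable_borel; apply: open_comp.
Qed.

Lemma isom_measurable (phi : isom M) :
  measurable_fun setT (phi : borel M -> borel M).
Proof. exact: (continuous_measurable_borel (@isom_continuous _ _ _ phi)). Qed.

Lemma iinv_measurable (phi : isom M) :
  measurable_fun setT (iinv phi : borel M -> borel M).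
Proof. exact: (continuous_measurable_borel (@iinv_continuous _ _ _ phi)). Qed.

Lemma countable_charts : exists C : nat -> set M,
  [/\ forall k, open (C k),
      forall k, exists2 c : chart R d M, atlas c & C k `<=` cdom c &
      \bigcup_k C k = setT].
Proof.
apply: (@second_countable_cover M (fun A => exists2 c : chart R d M, atlas c & A `<=` cdom c)).
- exact: (@m_countable _ _ M).
- by exists (chart_at point) => //; exact: atlas_at.
- by move=> A B AB [c ac Bc]; exists c => //; exact: subset_trans Bc.
- move=> x; exists (cdom (chart_at x)); split; last by exists (chart_at x) => //; exact: atlas_at.
    by have [] := atlas_chart (@atlas_at _ _ M x).
  exact: dom_at.
Qed.

(** Cutting [A] along the disjointified cover and summing makes equality of measures a local
    question, for infinite measures too. *)
Lemma eq_measure_cover dT (T : measurableType dT) (m1 m2 : {measure set T -> \bar R})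
    (C : nat -> set T) : (forall k, measurable (C k)) -> \bigcup_k C k = setT ->
  (forall k A, measurable A -> A `<=` C k -> m1 A = m2 A) ->
  forall A, measurable A -> m1 A = m2 A.
Proof.
move=> mC CT m12 A mA.
have mD k : measurable (seqDU C k).
  by apply: measurableD => //; apply: bigsetU_measurable.
have -> : A = \bigcup_k (A `&` seqDU C k).
  by rewrite -setI_bigcupr -seqDU_bigcup_eq CT setIT.
have mAD k : measurable (A `&` seqDU C k) by exact: measurableI.
have tAD : trivIset setT (fun k => A `&` seqDU C k).
  by apply: trivIset_setIl; exact: trivIset_seqDU.
rewrite !measure_semi_bigcup//; try exact: bigcup_measurable.
apply: eq_eseriesr => k _; apply: (m12 k) => //.
by apply: subset_trans (@subset_seqDU _ C k); exact: subIsetr.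
Qed.

(** The pushforward bundled as a measure, so that it can be a witness where a definition chooses
    among measures. *)
Definition image_measure d1 d2 (T1 : measurableType d1) (T2 : measurableType d2)
  (m : {measure set T1 -> \bar R}) (f : T1 -> T2) (mf : measurable_fun setT f) :
  {measure set T2 -> \bar R}.
Proof.
by unshelve refine (pushforward m f : {measure set T2 -> \bar R}); exact: mf.
Defined.

Lemma image_measureE d1 d2 (T1 : measurableType d1) (T2 : measurableType d2)
  (m : {measure set T1 -> \bar R}) (f : T1 -> T2) (mf : measurable_fun setT f) A :
  image_measure m mf A = m (f @^-1` A).
Proof. by []. Qed.

Lemma vol_isom (phi : isom M) (A : set (borel M)) : measurable A ->
  mu (phi @^-1` A) = mu A.
Proof.
have [lam [_ mulam]] := vol_spec M.
have [C [oC Cc CT]] := countable_charts.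
have mphi := isom_measurable phi.
have mi := iinv_measurable phi.
rewrite -(image_measureE mu mphi); move: A.
apply: (@eq_measure_cover _ _ (image_measure mu mphi) mu
  (fun k => iinv phi @^-1` C k)).
- move=> k; rewrite -[X in measurable X]setTI; apply: mi => //.
  exact: open_measurable_borel.
- by rewrite -preimage_bigcup CT preimage_setT.
(* [B] is read in the transported chart and its preimage in [c]. Both have the same coordinate image
   and the same Gram matrices there. *)
move=> k B mB BC; have [c ac Ckc] := Cc k.
have Bc : B `<=` cdom (push_chart phi c) by move=> x /BC /Ckc.
have mpB : measurable (phi @^-1` B : set (borel M)).
  by rewrite -[X in measurable X]setTI; exact: mphi.
have pBc : phi @^-1` B `<=` cdom c by move=> x /= /Bc /=; rewrite ifunK.
rewrite image_measureE; rewrite (mulam c _ ac mpB pBc).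
rewrite (mulam _ B (push_chart_atlas phi ac) mB Bc).
rewrite (_ : cmap (push_chart phi c) @` B = cmap c @` (phi @^-1` B)); last first.
  apply/seteqP; split => _ [x Bx <-] /=.
    by exists (iinv phi x) => //=; rewrite iinvK.
  by exists (phi x) => //=; rewrite ifunK.
apply: eq_integral => p /set_mem [x Bx <-].
by rewrite in_push_chart//; exists x => //; exact: pBc.
Qed.

Lemma vol_negligible_isom (phi : isom M) (P : M -> Prop) :
  {ae mu, forall x, P x} -> {ae mu, forall x, P (iinv phi x)}.
Proof.
move=> [N [mN N0 sN]].
have mN' : measurable (iinv phi @^-1` N : set (borel M)).
  by rewrite -[X in measurable X]setTI; exact: iinv_measurable.
exists (iinv phi @^-1` N); split => //; last by move=> x /= nP; apply: sN.
rewrite -(vol_isom phi mN') -comp_preimage.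
by rewrite (_ : iinv phi \o phi = id)//; apply/funext => x; exact: ifunK.
Qed.

End Volume.

(** * Local finiteness of the volume and the density of an isometry *)

Section LocalFiniteness.
Variables (R : realType) (n : nat) (M : spacetime R n).
Local Notation d := n.+2.
Local Notation mu := (vol M).

(** Leibniz formula, each entry being bounded by the maximum norm. *)
Lemma det_le_norm (m : nat) (A : 'M[R]_m.+1) (b : R) : `|A| <= b ->
  `|\det A| <= \sum_(s : {perm 'I_m.+1}) b ^+ m.+1.
Proof.
move=> Ab; apply: le_trans (ler_norm_sum _ _ _) _; apply: ler_sum => s _.
rewrite normrM normrX normrN1 expr1n mul1r normr_prod.
rewrite -[X in _ <= _ ^+ X]card_ord -prodr_const; apply: ler_prod => i _.
rewrite normr_ge0 /=; apply: le_trans Ab.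
rewrite [leRHS]/Num.norm /= mx_normrE.
exact: (le_bigmax _ (fun ij => `|A ij.1 ij.2|) (i, s i)).
Qed.

Lemma coord_box_measurable (a b : 'rV[R]_d) :
  measurable ([set v : 'rV[R]_d | forall i, a 0 i <= v 0 i < b 0 i]
    : set (borel 'rV[R]_d)).
Proof.
rewrite (_ : [set _ | _] = \bigcap_(i in [set: 'I_d])
  ([set v : 'rV[R]_d | v 0 i < b 0 i] `\` [set v : 'rV[R]_d | v 0 i < a 0 i])); last first.
  apply/seteqP; split => [v vab i _|v vab i] /=.
    by have /andP[av ->] := vab i; split => //; rewrite ltNge av.
  by have [/= -> /negP] := vab i I; rewrite -leNgt andbT.
have mlt i r : measurable ([set v : 'rV[R]_d | v 0 i < r] : set (borel 'rV[R]_d)).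
  apply: open_measurable_borel.
  by apply: (@open_comp _ _ (fun v : 'rV[R]_d => v 0 i) [set x | x < r]);
    [move=> v _; exact: coord_continuous|exact: open_lt].
by apply: fin_bigcap_measurable => // i _; exact: measurableD.
Qed.

(** Near [x] the density is bounded and the coordinates stay in a box of finite Lebesgue measure.
    This gives the sigma-finiteness behind uniqueness of Radon-Nikodym densities. *)
Lemma vol_locally_finite (x : M) :
  exists U : set M, [/\ open U, U x & (mu U < +oo)%E].
Proof.
have [lam [lamE mulam]] := vol_spec M.
have ac := @atlas_at _ _ M x; have cx := @dom_at _ _ M x.
set c := chart_at x in ac cx.
have [oc oi K cm ci] := atlas_chart ac.
pose G := in_chart (@metric R n M) c.
have [cG _] := @metric_smooth _ _ M c ac 0%N.
(* The margin 1 lets the bound on the Gram matrix persist near [p0]; [B] is then the Leibniz bound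
   on the density. The box is half-open because [is_lebesgue] prescribes the measure of such
   boxes. *)
pose p0 := cmap c x; pose b := `|G p0| + 1.
pose B := Num.sqrt (\sum_(s : {perm 'I_d}) b ^+ d).
pose lo : 'rV[R]_d := \row_i (p0 0 i - 1); pose hi : 'rV[R]_d := \row_i (p0 0 i + 1).
pose Box := [set v : 'rV[R]_d | forall i, lo 0 i <= v 0 i < hi 0 i].
have nG : \forall p \near p0, `|G p| <= b.
  have Gp0 : G @ p0 --> G p0 by apply: cG; exists x.
  by apply: (cvgr_norm_le _ Gp0); rewrite ltrDl.
have nBox : \forall p \near p0, Box p.
  apply/nbhs_ballP; exists 1 => //= p [_ bp] i; have := bp 0 i.
  rewrite /ball /= !mxE ltr_norml => /andP[]; lra.
have nx : nbhs x [set y | cdom c y /\ (`|G (cmap c y)| <= b /\ Box (cmap c y))].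
  apply: filterI; first exact: cdom_nbhs.
  have cmx : cmap c @ x --> p0 := cm x cx.
  have nGB : nbhs p0 ([set p | `|G p| <= b] `&` Box) by exact: filterI.
  exact: (cmx _ nGB).
have [U [oU Ux] UN] : exists2 U, open_nbhs x U &
    U `<=` [set y | cdom c y /\ (`|G (cmap c y)| <= b /\ Box (cmap c y))].
  by move: nx; rewrite nbhsE.
exists U; split => //.
have mU : measurable (U : set (borel M)) by exact: open_measurable_borel.
have Uc : U `<=` cdom c by move=> y /UN[].
rewrite (mulam c U ac mU Uc) integral_mkcond.
have mBox := coord_box_measurable lo hi.
have B0 : 0 <= B by exact: sqrtr_ge0.
have : (\int[lam]_p (((fun p => (Num.sqrt `|\det (G p)|)%:E) \_ (cmap c @` U)) p) <=
   \int[lam]_p ((cst B%:E) \_ (Box : set (borel 'rV[R]_d)) p))%E.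
  apply: le_integral_arbitrary => p; rewrite !patchE; case: ifPn => //.
  - move=> /set_mem [y /UN [cy [Gy By]] <-]; rewrite mem_set//= lee_fin.
    by rewrite ler_wsqrtr// det_le_norm.
  - by move=> _; case: ifP.
move=> /le_lt_trans; apply; rewrite -integral_mkcond integral_cst//.
have lohi i : lo 0 i <= hi 0 i by rewrite !mxE; lra.
by rewrite (lamE lo hi lohi) -EFinM ltry.
Qed.

Lemma volRN_isom (phi : isom M) : {ae mu, forall x, volRN phi x = 1}.
Proof.
have [mf f0 fE] : [/\ measurable_fun setT (volRN phi : borel M -> R),
    forall x, 0 <= volRN phi x &
    forall A : set (borel M), measurable A ->
      mu ((phi : M -> M) @^-1` A) = (\int[mu]_(x in A) (volRN phi x)%:E)%E].
  rewrite /volRN /choose_or; case: pselect => [h|[]]; first by case: cid.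
  (* The constant 1 is a density, so the choice in [volRN] does not fall back on its default 0. *)
  exists (cst 1); split => // A mA.
  by rewrite vol_isom// -[LHS]mul1e; apply/esym; exact: (integral_cst mu mA 1%E).
have [C [oC Cfin CT]] : exists C : nat -> set M,
    [/\ forall k, open (C k),
       forall k, exists U : set M, [/\ open U, C k `<=` U & (mu U < +oo)%E] &
       \bigcup_k C k = setT].
  apply: (@second_countable_cover M (fun A =>
    exists U : set M, [/\ open U, A `<=` U & (mu U < +oo)%E])).
  - exact: (@m_countable _ _ M).
  - by exists set0; split => //; [exact: open0|rewrite measure0].
  - by move=> A B AB [U [oU BU Uf]]; exists U; split => //; exact: subset_trans BU.
  - move=> x; have [U [oU Ux Uf]] := vol_locally_finite x.
    by exists U; split => //; exists U; split => //; exact: subset_refl.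
have mC k : measurable (C k : set (borel M)) by exact: open_measurable_borel.
have muC k : (mu (C k) < +oo)%E.
  have [U [oU CU Uf]] := Cfin k; apply: le_lt_trans Uf.
  by apply: le_measure => //; rewrite inE//; exact: open_measurable_borel.
(* On a set of finite volume, the chosen density and 1 are integrable with equal integrals over all
   measurable subsets. *)
have aek k : {ae mu, forall x, C k x -> (volRN phi x)%:E = 1%E}.
  apply: (@integral_ae_eq _ _ _ mu _ (mC k) (cst 1%E)).
  - apply/integrableP; split; first exact/measurable_EFinP/(measurable_funS measurableT).
    under eq_integral do rewrite gee0_abs ?lee_fin//.
    by rewrite -fE// vol_isom.
  - exact: measurable_cst.
  - by move=> E EC mE; rewrite -fE// vol_isom// -[LHS]mul1e; apply/esym;
    exact: (integral_cst mu mE 1%E).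
apply: filterS (ae_foralln aek) => x Cx.
have : (\bigcup_k C k) x by rewrite CT.
by move=> [k _ /Cx []].
Qed.

End LocalFiniteness.

(** * Left translation by an isometry *)

Section Groupoid.
Variables (R : realType) (n : nat) (M : spacetime R n).
Local Notation d := n.+2.

Lemma arrow_eq (x y : M) (a b : arrow x y) : amx a = amx b -> a = b.
Proof.
by case: a b => A pA [B pB] /= AB; subst B; congr Arrow; exact: Prop_irrelevance.
Qed.

Lemma poincareV (x y : M) (A : 'M[R]_d) :
  poincare x y A -> A \in unitmx /\ poincare y x (invmx A).
Proof.
move=> [gA oA tA].
have Au : A \in unitmx.
  rewrite unitmxE unitfE; apply: contraTneq oA => ->.
  by rewrite mulr0 mul0r ltxx.
split=> //; split => [v w||v].
- by rewrite -gA !mulmxKV.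
- rewrite det_inv; move: oA.
  have dA : \det A != 0 by rewrite -unitfE -unitmxE.
  have -> : ori x * \det A * ori y = ori y * (\det A)^-1 * ori x * (\det A ^+ 2).
    by field.
  by rewrite pmulr_lgt0// exprn_even_gt0.
- by rewrite tA mulmxKV.
Qed.

Lemma tmap_iinv (phi : isom M) (x : M) :
  tmap (iinv phi) x *m tmap phi (iinv phi x) = 1%:M.
Proof.
have := jacobian_local_rep (iinv_smooth phi) (ifun_smooth phi) (@atlas_at _ _ M x)
  (@atlas_at _ _ M (iinv phi x)) (@atlas_at _ _ M (phi (iinv phi x)))
  (@dom_at _ _ M x) (@dom_at _ _ M (iinv phi x)) (@dom_at _ _ M (phi (iinv phi x))).
rewrite (_ : phi \o iinv phi = id); last by apply/funext => y; exact: iinvK.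
rewrite /tmap => <-; rewrite iinvK; apply: jacobian_near_id.
have ax := @atlas_at _ _ M x; have [_ oi K _ _] := atlas_chart ax.
have : nbhs (cmap (chart_at x) x) (cimg (chart_at x)).
  by apply: open_nbhs_nbhs; split => //; exists x => //; exact: dom_at.
by apply: filterS => _ [y cy <-]; rewrite /local_rep /= K.
Qed.

Lemma iinv_poincare (phi : isom M) (x : M) :
  poincare x (iinv phi x) (tmap (iinv phi) x).
Proof.
have p := ifun_poincare phi (iinv phi x); rewrite iinvK in p.
have [pu pV] := poincareV p.
have -> // : tmap (iinv phi) x = invmx (tmap phi (iinv phi x)).
by rewrite -[LHS](mulmxK pu) (tmap_iinv phi x) mul1mx.
Qed.

Definition isom_inv (phi : isom M) : isom M :=
  Isom (iinvK phi) (ifunK phi) (iinv_smooth phi) (ifun_smooth phi)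
    (iinv_poincare phi).

(** [bis_to] is [bis] carried along the propositional equality [iinvK phi x]. A property generalized
    over the target may be checked on [bis], which avoids rewriting under a dependent type. *)
Lemma bis_to_ind (phi : isom M) (x : M)
    (P : forall z, arrow (iinv phi x) z -> Prop) :
  P _ (bis phi (iinv phi x)) -> P x (bis_to phi x).
Proof.
have key (y z w : M) (a : arrow y z) (e : z = w)
    (P' : forall z, arrow y z -> Prop) :
    P' z a -> P' w (eq_rect z (fun t => arrow y t) a w e) by case: _ / e.
exact: (key _ _ _ _ (iinvK phi x) P).
Qed.

Lemma amx_bis_to (phi : isom M) (x : M) : amx (bis_to phi x) = tmap phi (iinv phi x).
Proof. exact: (@bis_to_ind phi x (fun z a => amx a = tmap phi (iinv phi x))). Qed.

Lemma bis_to_bis_inv (phi : isom M) (x : M) :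
  acomp (bis_to phi x) (bis (isom_inv phi) x) = aid x.
Proof. by apply: arrow_eq; rewrite /= amx_bis_to; exact: tmap_iinv. Qed.

Lemma bis_inv_bis_to (phi : isom M) (x : M) :
  acomp (bis (isom_inv phi) x) (bis_to phi x) = aid (iinv phi x).
Proof.
by apply: arrow_eq; rewrite /= amx_bis_to; apply: mulmx1C; exact: tmap_iinv.
Qed.

Definition left_bis (phi : isom M) (b : garrow M) : garrow M :=
  GArrow (acomp (bis phi (gtgt b)) (garr b)).

(** Reading targets in the chart transported from [c'] leaves the matrix of the arrow unchanged, so
    a basic ball pulls back to one of the same radius. *)
Lemma left_bis_continuous (phi : isom M) : continuous (left_bis phi).
Proof.
apply/continuousP => A oA; suff : gopen (left_bis phi @^-1` A) by [].
move=> a Aa c c' ac ac' ca c'a.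
have c'fa : cdom (push_chart phi c') (gtgt (left_bis phi a)) by rewrite /= ifunK.
have [e e0 eA] := oA _ Aa c _ ac (push_chart_atlas phi ac') ca c'fa.
have arrE b : cdom c' (gtgt b) ->
    arrow_in c (push_chart phi c') (left_bis phi b) = arrow_in c c' b.
  move=> c'b; rewrite /arrow_in /left_bis /=.
  have := to_push_chart phi ac' c'b.
  move: (from_chart c _) (to_chart c' _) (tmap _ _) (to_chart _ _) => F T D T' <-.
  by rewrite !mulmxA.
exists e; first exact: e0.
move=> b [cb c'b sb tb ab]; apply: eA; split.
- exact: cb.
- by rewrite /= ifunK.
- exact: sb.
- by rewrite /= !ifunK.
- by rewrite (arrE _ c'b) (arrE _ c'a).
Qed.

(** In a chart and its transport the matrix is constantly 1, so only the base points have to be kept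
    close. *)
Lemma bis_continuous (phi : isom M) : continuous (fun y => GArrow (bis phi y)).
Proof.
apply/continuousP => A oA; rewrite openE => y Ay.
have ac := @atlas_at _ _ M y; have cy := @dom_at _ _ M y; set c := chart_at y in ac cy.
have c'y : cdom (push_chart phi c) (phi y) by rewrite /= ifunK.
have [e e0 eA] := oA _ Ay c _ ac (push_chart_atlas phi ac) cy c'y.
have [_ _ _ cm _] := atlas_chart ac.
have cmy : cmap c @ y --> cmap c y := cm y cy.
have nc : nbhs y (cdom c) by exact: cdom_nbhs.
have nd : \forall z \near y, `|cmap c z - cmap c y| < e by exact: cvgr_distC_lt.
apply: filterS2 nc nd => z cz dz; apply: eA; split.
- exact: cz.
- by rewrite /= ifunK.
- exact: dz.
- by rewrite /= !ifunK.
- have E t : cdom c t ->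
      arrow_in c (push_chart phi c) (GArrow (bis phi t)) = 1%:M.
    exact: bis_in_push_chart.
  by rewrite (E z cz) (E y cy) subrr normr0.
Qed.

Lemma ginc_Ltrans_bis (phi : isom M) (x : M) (b : arrows_to x) :
  ginc (Ltrans (bis phi x) b) = left_bis phi (ginc b).
Proof. by []. Qed.

Lemma ginc_Ltrans_bis_to (phi : isom M) (x : M) (b : arrows_to (iinv phi x)) :
  ginc (Ltrans (bis_to phi x) b) = left_bis phi (ginc b).
Proof.
exact: (@bis_to_ind phi x (fun z a => GArrow (acomp a (arr b)) = left_bis phi (ginc b))).
Qed.

(** The fibres carry the topology induced by [ginc], so a map of fibres that restricts a continuous
    map of the groupoid is continuous, hence Borel. *)
Lemma borel_to_measurable (x y : M) (f : arrows_to x -> arrows_to y)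
    (g : garrow M -> garrow M) : continuous g ->
  (forall b, ginc (f b) = g (ginc b)) ->
  measurable_fun setT (f : borel_to x -> borel_to y).
Proof.
move=> cg fg; apply: (@continuous_measurable_borel _ _
  (f : initial_topology (@ginc _ _ M x) -> initial_topology (@ginc _ _ M y))).
apply/continuousP => _ [A oA <-].
exists (g @^-1` A); first by move/continuousP : cg; apply.
by apply/seteqP; split => b /=; rewrite fg.
Qed.

Lemma Ltrans_bis_measurable (phi : isom M) (x : M) :
  measurable_fun setT (Ltrans (bis phi x) : borel_to x -> borel_to (phi x)).
Proof.
by apply: (borel_to_measurable (@left_bis_continuous phi)) => b; rewrite ginc_Ltrans_bis.
Qed.

Lemma Ltrans_bis_to_measurable (phi : isom M) (x : M) :
  measurable_fun setT (Ltrans (bis_to phi x) : borel_to (iinv phi x) -> borel_to x).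
Proof.
by apply: (borel_to_measurable (@left_bis_continuous phi)) => b; rewrite ginc_Ltrans_bis_to.
Qed.

Lemma Ltrans_comp (x y z : M) (a : arrow y z) (b : arrow x y) (c : arrows_to x) :
  Ltrans a (Ltrans b c) = Ltrans (acomp a b) c.
Proof.
by case: c => s c; rewrite /Ltrans /=; congr ArrowTo; apply: arrow_eq; rewrite /= mulmxA.
Qed.

Lemma Ltrans_id (x : M) (c : arrows_to x) : Ltrans (aid x) c = c.
Proof.
by case: c => s c; rewrite /Ltrans /=; congr ArrowTo; apply: arrow_eq; rewrite /= mulmx1.
Qed.

Lemma Ltrans_bis_toK (phi : isom M) (x : M) :
  cancel (Ltrans (bis_to phi x)) (Ltrans (bis (isom_inv phi) x)).
Proof. by move=> b; rewrite Ltrans_comp bis_inv_bis_to Ltrans_id. Qed.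

Lemma Ltrans_bis_invK (phi : isom M) (x : M) :
  cancel (Ltrans (bis (isom_inv phi) x)) (Ltrans (bis_to phi x)).
Proof. by move=> b; rewrite Ltrans_comp bis_to_bis_inv Ltrans_id. Qed.

End Groupoid.

(** * Operators and traces *)

Lemma choose_or_unique (T : Type) (x0 : T) (P : T -> Prop) (x : T) :
  P x -> (forall y, P y -> y = x) -> choose_or x0 P = x.
Proof.
move=> Px xP; rewrite /choose_or; case: pselect => [h|[]]; last by exists x.
by case: cid => y Py /=; exact: xP.
Qed.

Section HilbertTheory.
Variable R : realType.
Implicit Types H K L : hilbert R.

Lemma ipDr H (u v w : H) : ip u (v + w) = ip u v + ip u w.
Proof. by rewrite /ip linearDl. Qed.

Lemma ipZr H (a : R[i]) (u v : H) : ip u (a *: v) = a * ip u v.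
Proof. by rewrite /ip linearZl_LR. Qed.

Lemma ip0r H (u : H) : ip u 0 = 0.
Proof. by rewrite -[0 in LHS](scale0r 0) ipZr mul0r. Qed.

Lemma ipNr H (u v : H) : ip u (- v) = - ip u v.
Proof. by rewrite -scaleN1r ipZr mulN1r. Qed.

Lemma ipBr H (u v w : H) : ip u (v - w) = ip u v - ip u w.
Proof. by rewrite ipDr ipNr. Qed.

Lemma ipC H (u v : H) : ip u v = Num.conj (ip v u).
Proof. by rewrite /ip [LHS]hermC expr0 mul1r. Qed.

Lemma ipDl H (u v w : H) : ip (v + w) u = ip v u + ip w u.
Proof. by rewrite ipC ipDr rmorphD /= -!ipC. Qed.

Lemma ipBl H (u v w : H) : ip (v - w) u = ip v u - ip w u.
Proof. by rewrite ipC ipBr rmorphB /= -!ipC. Qed.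

Lemma ipZl H (a : R[i]) (u v : H) : ip (a *: v) u = Num.conj a * ip v u.
Proof. by rewrite ipC ipZr rmorphM /= -!ipC. Qed.

Lemma ip_eq0 H (v : H) : ip v v = 0 -> v = 0.
Proof.
move=> v0; apply/eqP; apply: contrapT => /negP nv.
by have := dnorm_gt0 (@hdot R H) v; rewrite nv; rewrite /ip in v0; rewrite v0 ltxx.
Qed.

Lemma ip_inj H (v w : H) : (forall u, ip u v = ip u w) -> v = w.
Proof. by move=> vw; apply/eqP; rewrite -subr_eq0; apply/eqP/ip_eq0; rewrite ipBr vw subrr. Qed.

(** The squared norm of [v - w] expands to zero. This identifies vectors of a direct integral of
    which only inner products are known. *)
Lemma ip_sub_eq0 H (v w : H) :
  ip v v = ip w w -> ip v w = ip w w -> ip w v = ip w w -> v = w.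
Proof.
move=> vv vw wv; apply/eqP; rewrite -subr_eq0; apply/eqP/ip_eq0.
by rewrite ipBr !ipBl vv vw wv !subrr.
Qed.

Lemma adjP H K (T : H -> K) (S : K -> H) : is_adj T S -> adj T = S.
Proof.
move=> TS; apply: choose_or_unique => // S' TS'; apply/funext => u.
by apply: ip_inj => v; rewrite ipC [RHS]ipC -TS -TS'.
Qed.

(** The inverse of an isometric surjection is an adjoint, and by uniqueness it is the one that [adj]
    selects. *)
Lemma unitary_adj H K (U : H -> K) : unitary U ->
  [/\ is_adj U (adj U), cancel U (adj U) & cancel (adj U) U].
Proof.
move=> [lU iU sU].
have Uinj v w : U v = U w -> v = w.
  by move=> E; apply: ip_inj => u; rewrite -!iU E.
pose S w := projT1 (cid (sU w)).
have US w : U (S w) = w by rewrite /S; case: cid.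
have aS : is_adj U S by move=> u v; rewrite -[in LHS](US u) iU.
rewrite (adjP aS); split => // v.
by apply: Uinj.
Qed.

Lemma unitary_adj_unitary H K (U : H -> K) : unitary U -> unitary (adj U).
Proof.
move=> UU; have [aU UK KU] := unitary_adj UU; have [lU iU _] := UU.
split => [a u v|u v|w]; last by exists (U w).
- by rewrite -[LHS]UK -[RHS]UK; congr (adj U _); rewrite KU lU !KU.
- by rewrite -iU !KU.
Qed.

Lemma adj_adj H K (U : H -> K) : unitary U -> adj (adj U) = U.
Proof.
by move=> /unitary_adj[aU _ _]; apply: adjP => u v; rewrite ipC -aU -ipC.
Qed.

Lemma adj_comp H K L (U : K -> L) (W : H -> K) : unitary U -> unitary W ->
  adj (U \o W) = adj W \o adj U.
Proof.
move=> /unitary_adj[aU _ _] /unitary_adj[aW _ _].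
by apply: adjP => u v /=; rewrite aU aW.
Qed.

Lemma hnorm_unitary H K (U : H -> K) v : unitary U -> hnorm (U v) = hnorm v.
Proof. by move=> [_ iU _]; have := iU v v; rewrite /ip /hnorm /dot_norm => ->. Qed.

Lemma bounded_unitary H K (U : H -> K) : unitary U -> bounded_op U.
Proof.
by move=> UU; split; [have [] := UU|exists 1 => v; rewrite hnorm_unitary// mul1r].
Qed.

Lemma hnorm_ge0 H (v : H) : 0 <= hnorm v.
Proof. exact: sqrtr_ge0. Qed.

Lemma bounded_comp H K L (T : K -> L) (S : H -> K) :
  bounded_op T -> bounded_op S -> bounded_op (T \o S).
Proof.
move=> [lT [c cT]] [lS [c' cS]]; split => [a u v /=|]; first by rewrite lS lT.
exists (`|c| * `|c'|) => v /=; apply: le_trans (cT _) _.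
apply: (@le_trans _ _ (`|c| * hnorm (S v))).
  by rewrite ler_wpM2r ?hnorm_ge0// ler_norm.
rewrite -mulrA ler_wpM2l//; apply: le_trans (cS v) _.
by rewrite ler_wpM2r ?hnorm_ge0// ler_norm.
Qed.

Lemma hnorm0 H : hnorm (0 : H) = 0.
Proof. by rewrite /hnorm /dot_norm -[@hdot R H 0 0]/(ip 0 0) ip0r sqrtr0. Qed.

Lemma bounded_op0 H K : bounded_op (fun _ : H => 0 : K).
Proof.
split=> [a u v|]; first by rewrite scaler0 addr0.
by exists 0 => v; rewrite hnorm0 mul0r.
Qed.

Lemma bounded_op_0 H K (T : H -> K) : bounded_op T -> T 0 = 0.
Proof. by move=> [lT _]; have := lT (-1) 0 0; rewrite !scaleN1r !addNr. Qed.

Definition unitary_conj H K (U : H -> K) (T : H -> H) : K -> K := U \o T \o adj U.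

Section Conjugation.
Context H K (U : H -> K) (UU : unitary U).

Let UK : cancel U (adj U). Proof. by have [] := unitary_adj UU. Qed.
Let KU : cancel (adj U) U. Proof. by have [] := unitary_adj UU. Qed.

Lemma unitary_conjK T : unitary_conj (adj U) (unitary_conj U T) = T.
Proof. by apply/funext => v; rewrite /unitary_conj adj_adj//= !UK. Qed.

Lemma unitary_conjVK T : unitary_conj U (unitary_conj (adj U) T) = T.
Proof. by apply/funext => v; rewrite /unitary_conj adj_adj//= !KU. Qed.

Lemma unitary_conjM S T :
  unitary_conj U (S \o T) = unitary_conj U S \o unitary_conj U T.
Proof. by apply/funext => v; rewrite /unitary_conj /= UK. Qed.

Lemma bounded_unitary_conj T : bounded_op T -> bounded_op (unitary_conj U T).
Proof.
move=> bT; apply: bounded_comp; last exact/bounded_unitary/unitary_adj_unitary.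
by apply: bounded_comp => //; exact: bounded_unitary.
Qed.

(** The sum along [e] for the conjugate is the sum along the pulled-back basis [adj U \o e] for [T];
    linearity keeps the zero padding. *)
Lemma is_trace_unitary_conj T t : is_trace T t -> is_trace (unitary_conj U T) t.
Proof.
have [_ iU _] := UU; have [aU _ _] := unitary_adj UU.
move=> Tt e /= eb.
have eb' : onb (adj U \o e).
  have [eij eii et] := eb.
  have [_ iV _] := unitary_adj_unitary UU.
  split => [i j ij|i|v ve] /=.
  - by rewrite iV eij.
  - rewrite iV; have [->|->] := eii i; [by left|right].
    exact/bounded_op_0/bounded_unitary/unitary_adj_unitary.
  - rewrite -(UK v) (et (U v)).
      exact/bounded_op_0/bounded_unitary/unitary_adj_unitary.
    by move=> i; rewrite aU; exact: ve.
have := Tt _ eb'; rewrite /unitary_conj; congr csum; apply/funext => k /=.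
by rewrite aU.
Qed.

End Conjugation.

(** Both operators have the same admissible values of the trace, so the choices agree even when no
    value exists. *)
Lemma tr_unitary_conj H K (U : H -> K) (T : H -> H) : unitary U ->
  tr (unitary_conj U T) = tr T.
Proof.
move=> UU; rewrite /tr; congr choose_or; apply/funext => t; apply/propext; split.
  move/(is_trace_unitary_conj (unitary_adj_unitary UU)).
  by rewrite unitary_conjK.
exact: is_trace_unitary_conj.
Qed.

(* This replaces the existence of an orthonormal basis: without one, every
   operator would have the same junk trace. *)
Lemma tr_zero H : tr (fun _ : H => 0) = 0 \/
  forall T : H -> H, tr T = tr (fun _ : H => 0).
Proof.
have z : is_trace (fun _ : H => 0) 0.
  move=> e _; split; apply: cvg_near_cst; apply: nearW => k;
  by rewrite /series /= big1// => i _; rewrite ip0r.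
have [[e eb]|noe] := pselect (exists e : nat -> H, onb e); [left|right => T].
  apply: choose_or_unique => // t /(_ e eb) te; have ze := z e eb.
  case: te ze => [te1 te2] [ze1 ze2].
  have E1 := norm_cvg_unique te1 ze1; have E2 := norm_cvg_unique te2 ze2.
  by case: t te1 te2 E1 E2 => a b _ _ /= -> ->.
rewrite /tr; congr choose_or; apply/funext => t; apply/propext.
by split => _ e eb; exfalso; apply: noe; exists e.
Qed.

(** Conjugation by a unitary is a multiplicative bijection that preserves boundedness in both
    directions. *)
Lemma commutant_unitary_conj H K (U : H -> K) (S : set (H -> H)) : unitary U ->
  [set unitary_conj U A | A in commutant S] =
  commutant [set unitary_conj U A | A in S].
Proof.
move=> UU; apply/seteqP; split => [_ [A [bA cA] <-]|B [bB cB]].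
  split; first exact: bounded_unitary_conj.
  by move=> _ [A' SA' <-]; rewrite -2!(unitary_conjM UU) cA.
exists (unitary_conj (adj U) B); last exact: unitary_conjVK.
split; first exact/bounded_unitary_conj/bB/unitary_adj_unitary.
move=> A SA; have := cB _ (ex_intro2 _ _ A SA erefl).
move/(congr1 (unitary_conj (adj U))).
have VM := unitary_conjM (unitary_adj_unitary UU).
by rewrite (VM (unitary_conj U A) B) (VM B (unitary_conj U A)) (unitary_conjK UU).
Qed.

End HilbertTheory.

(** * Direct integrals *)

Section DirectIntegral.
Variables (R : realType) (n : nat) (M : spacetime R n).
Local Notation mu := (vol M).
Variables (F : cfield M).

(* Typeclass resolution does not see through [borel M] to the measurable
   structure, so [filterS] has to be instantiated by hand. *)
Lemma ae_vol_imply (P Q : M -> Prop) : {ae mu, forall x, P x} ->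
  (forall x, P x -> Q x) -> {ae mu, forall x, Q x}.
Proof.
by move=> aP PQ; apply: (@filterS _ _ (ae_filter_ringOfSetsType mu) P Q).
Qed.

Lemma ae_vol_imply2 (P P' Q : M -> Prop) : {ae mu, forall x, P x} ->
  {ae mu, forall x, P' x} -> (forall x, P x -> P' x -> Q x) ->
  {ae mu, forall x, Q x}.
Proof.
by move=> aP aP' PQ; apply: (@filterS2 _ _ (ae_filter_ringOfSetsType mu) P P' Q).
Qed.

Lemma isom_invK (phi : isom M) : isom_inv (isom_inv phi) = phi.
Proof. by case: phi => *; congr Isom; exact: Prop_irrelevance. Qed.

Lemma measurable_continuous (f : M -> R) : continuous f ->
  measurable_fun setT (f : borel M -> R).
Proof.
move=> cf; apply: (measurability _ (RGenOpens.measurableE R)) => _ [_ [a [b ->] <-]].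
rewrite setTI; apply: open_measurable_borel; by apply: open_comp.
Qed.

Lemma hnorm_sqr (H : hilbert R) (v : H) : hnorm v ^+ 2 = complex.Re (ip v v).
Proof.
rewrite sqr_sqrtr//; have [->|v0] := eqVneq v 0; first by rewrite linear0l.
by have := neq0_dnorm_gt0 (s := @hdot R H) v v0; rewrite ltcE /= => /andP[_ /ltW].
Qed.

Lemma Re_polarization (H : hilbert R) (u v : H) :
  complex.Re (ip u v) = (hnorm (u + v) ^+ 2 - hnorm u ^+ 2 - hnorm v ^+ 2) / 2.
Proof.
rewrite !hnorm_sqr ipDr !ipDl (ipC v u).
case: (ip u u) (ip u v) (ip v v) => [a ?] [b ?] [c ?] /=.
by field.
Qed.

(** A continuous field only provides continuity of norms. Polarization yields the real part, and
    multiplying [xi] by [- 'i] turns the imaginary part into a real one. *)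
Lemma csec_cmeasurable (xi eta : section F) : csec xi -> csec eta ->
  cmeasurable (fun x : borel M => ip (eta x) (xi x)).
Proof.
have mRe (xi1 xi2 : section F) : csec xi1 -> csec xi2 ->
    measurable_fun setT (fun x : borel M => complex.Re (ip (xi2 x) (xi1 x))).
  move=> c1 c2; under eq_fun do rewrite Re_polarization.
  have c12 : csec (fun x => xi2 x + xi1 x).
    have := csec_lin 1 c2 c1; congr csec.
    by apply: functional_extensionality_dep => x; rewrite scale1r.
  have m zeta : csec zeta ->
      measurable_fun setT (fun x : borel M => hnorm (zeta x : F x) ^+ 2).
    by move=> /csec_norm/measurable_continuous ?; exact: measurable_funX.
  apply: measurable_funM => //; apply: measurable_funB; last exact: m.
  by apply: measurable_funB; apply: m.
move=> cx ce; split; first exact: mRe.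
have cix : csec (fun x => (- 'i) *: xi x).
  have := csec_lin (- 'i) cx (csec0 F); congr csec.
  by apply: functional_extensionality_dep => x; rewrite addr0.
have := mRe _ _ cix ce; congr measurable_fun; apply/funext => x.
by rewrite ipZr; case: (ip _ _) => a b /=; rewrite oppr0 mul0r mulN1r sub0r opprK.
Qed.

Lemma csec_msec (xi : section F) : csec xi -> msec xi.
Proof. by move=> cx eta ce; exact: csec_cmeasurable. Qed.

Variable V : urep F.

(** The action underlying [bigV], without the density factor, which is 1 almost everywhere. On
    sections it has the exact inverse [transport (isom_inv phi)]. *)
Definition transport (phi : isom M) (xi : section F) : section F :=
  fun x => V _ _ (bis_to phi x) (xi (iinv phi x)).

(** The endpoints [iinv phi (phi y)] and [y] are only propositionally equal, so an arrow between
    them with identity matrix is not literally [aid]. *)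
Lemma rep_unit (xi : section F) (z y : M) (a : arrow z y) :
  z = y -> amx a = 1%:M -> V _ _ a (xi z) = xi y.
Proof.
move=> zy; subst y => a1; rewrite (_ : a = aid z) ?rep_id//.
exact: arrow_eq.
Qed.

Lemma transport_invK phi : cancel (transport phi) (transport (isom_inv phi)).
Proof.
move=> xi; apply: functional_extensionality_dep => y; rewrite /transport -rep_comp.
apply: rep_unit; first exact: ifunK.
by rewrite /= !amx_bis_to; apply: mulmx1C; exact: tmap_iinv.
Qed.

Lemma transportK phi : cancel (transport (isom_inv phi)) (transport phi).
Proof. by move=> xi; rewrite -[X in transport X](isom_invK phi) transport_invK. Qed.

(** The pairing with a continuous section is the measurable matrix coefficient of [rep_meas]
    evaluated along the continuous bisection. *)
Lemma transport_msec phi xi : msec xi -> msec (transport phi xi).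
Proof.
move=> mx eta ce.
have [mRe mIm] := rep_meas V mx (csec_msec ce).
have mb : measurable_fun setT ((fun x => GArrow (bis_to phi x)) : borel M -> borel (garrow M)).
  apply: continuous_measurable_borel.
  rewrite (_ : (fun x => _) = (fun y => GArrow (bis phi y)) \o iinv phi); last first.
    apply/funext => x /=.
    exact: (@bis_to_ind _ _ _ phi x (fun z a => GArrow a = GArrow (bis phi (iinv phi x)))).
  move=> x; apply: continuous_comp; first exact: iinv_continuous.
  exact: bis_continuous.
by split; [exact: (measurableT_comp mRe mb)|exact: (measurableT_comp mIm mb)].
Qed.

Lemma cintegral_isom (phi : isom M) (f : M -> R[i]) :
  cintegral mu (fun x : borel M => f (iinv phi x)) = cintegral mu (f : borel M -> R[i]).
Proof.
rewrite (@cintegral_transfer _ _ _ _ _ mu mu phi (iinv phi)).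
- by congr cintegral; apply/funext => x /=; rewrite ifunK.
- exact: isom_measurable.
- exact: iinv_measurable.
- exact: iinvK.
- exact: ifunK.
- by move=> A mA; rewrite vol_isom.
Qed.

Lemma transport_L2 phi xi : L2sec xi -> L2sec (transport phi xi).
Proof.
move=> [mx fx]; split; first exact: transport_msec.
rewrite (@integral_transfer _ _ _ _ _ mu mu phi (iinv phi)).
- suff -> : (fun x => (hnorm (transport phi xi (phi x)) ^+ 2)%:E) =
    (fun x => (hnorm (xi x) ^+ 2)%:E) by [].
  apply/funext => x; rewrite /transport hnorm_unitary; last exact: rep_unitary.
  by rewrite ifunK.
- exact: isom_measurable.
- exact: iinv_measurable.
- exact: iinvK.
- exact: ifunK.
- by move=> A mA; rewrite vol_isom.
Qed.

Lemma transport_ip phi xi eta :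
  cintegral mu (fun x => ip (transport phi xi x) (transport phi eta x)) =
  cintegral mu (fun x => ip (xi x) (eta x)).
Proof.
rewrite -(cintegral_isom phi (fun x => ip (xi x) (eta x))).
congr cintegral; apply/funext => x; rewrite /transport.
by have [_ -> _] := rep_unitary V (bis_to phi x).
Qed.

Lemma transport_ae phi xi eta : ae_sec xi eta ->
  ae_sec (transport phi xi) (transport phi eta).
Proof.
move=> /(vol_negligible_isom phi) ae; apply: ae_vol_imply ae _ => x e.
by rewrite /transport e.
Qed.

Variable K : dintegral F.

Lemma dcls_ae xi eta : L2sec xi -> L2sec eta -> ae_sec xi eta ->
  dcls K xi = dcls K eta.
Proof.
move=> lx le ae; apply: ip_sub_eq0; rewrite !dcls_ip//;
  by apply: ae_eq_cintegral; apply: ae_vol_imply ae _ => x ->.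
Qed.

Lemma lift_opP (w : section F -> section F) (W : K -> K) :
  acts_as w W -> lift_op w = W.
Proof.
move=> aW; apply: choose_or_unique => // W' [_ aW']; apply/funext => v.
have [xi lx <-] := dcls_surj v; have [_ {}aW] := aW.
have [e1 l1 [ae1 ->]] := aW' _ lx; have [e2 l2 [ae2 ->]] := aW _ lx.
by apply: dcls_ae => //; apply: ae_vol_imply2 ae1 ae2 _ => x -> ->.
Qed.

Lemma lift_op_none (w : section F -> section F) :
  ~ (exists W : K -> K, acts_as w W) -> lift_op w = (fun _ : K => 0).
Proof. by rewrite /lift_op /choose_or; case: pselect. Qed.

(** [acts_as] only sees [w] up to null sets, so both choices are made from the same predicate. *)
Lemma lift_op_ae (w w' : section F -> section F) :
  (forall xi, ae_sec (w xi) (w' xi)) -> lift_op w = lift_op w' :> (K -> K).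
Proof.
move=> ww'; congr choose_or; apply/funext => W; apply/propext.
have key (w1 w2 : section F -> section F) : (forall xi, ae_sec (w1 xi) (w2 xi)) ->
    acts_as w1 W -> acts_as w2 W.
  move=> w12 [bW aW]; split => // xi /aW [eta le [ae ->]].
  by exists eta => //; split => //; apply: ae_vol_imply2 ae (w12 xi) _ => x -> ->.
by split; apply: key => // xi; apply: ae_vol_imply (ww' xi) _ => x ->.
Qed.

Lemma lift_op_bounded (w : section F -> section F) : bounded_op (lift_op w : K -> K).
Proof.
have [[W aW]|none] := pselect (exists W : K -> K, acts_as w W).
  by rewrite (lift_opP aW); case: aW.
by rewrite lift_op_none//; exact: bounded_op0.
Qed.

(** An operator [W] is built by transporting chosen representatives of classes. It is shown to be
    unitary, and it acts as the formula of [bigV] because the density is 1 almost everywhere. *)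
Lemma bigV_unitary_dcls phi : unitary (bigV K V phi) /\
  forall xi, L2sec xi -> bigV K V phi (dcls K xi) = dcls K (transport phi xi).
Proof.
have pick v : exists xi, L2sec xi /\ dcls K xi = v.
  by have [xi lx <-] := @dcls_surj _ _ _ _ K v; exists xi.
pose s v := projT1 (cid (pick v)).
have sL v : L2sec (s v) by rewrite /s; case: cid => ? [].
have sE v : dcls K (s v) = v by rewrite /s; case: cid => ? [].
pose W v := dcls K (transport phi (s v)).
have Wip u v : ip (W u) (W v) = ip u v.
  rewrite dcls_ip; try exact: transport_L2.
  by rewrite transport_ip -(dcls_ip K (sL u) (sL v)) !sE.
(* The representative chosen for the class of [xi] need not be [xi]; preservation of inner products
   shows that the class of the transport does not depend on it. *)
have Wd xi : L2sec xi -> W (dcls K xi) = dcls K (transport phi xi).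
  move=> lx; have lt := transport_L2 phi lx.
  apply: ip_sub_eq0; rewrite ?Wip !dcls_ip//; try exact: transport_L2.
  - by rewrite transport_ip.
  - by rewrite !transport_ip -!(dcls_ip K)// sE.
  - by rewrite !transport_ip -!(dcls_ip K)// sE.
have WU : unitary W.
  split => // [a u v|w].
    (* A map preserving inner products is linear: the squared norm of its linearity defect expands
       to zero. *)
    apply/eqP; rewrite -subr_eq0; apply/eqP/ip_eq0.
    rewrite !(ipBr, ipBl, ipDr, ipDl, ipZr, ipZl) !Wip.
    rewrite !(ipDr, ipDl, ipZr, ipZl); ring.
  exists (dcls K (transport (isom_inv phi) (s w))).
  by rewrite Wd ?transportK ?sE//; exact: transport_L2.
suff -> : bigV K V phi = W by split.
rewrite /bigV (@lift_op_ae _ (transport phi)).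
  apply: lift_opP; split; first exact: bounded_unitary.
  move=> xi lx; exists (transport phi xi); first exact: transport_L2.
  by split; [exact: aeW|exact: Wd].
move=> xi; apply: ae_vol_imply (volRN_isom phi) _ => x ->.
by rewrite sqrtr1 scale1r.
Qed.

Lemma bigV_adj_dcls phi xi : L2sec xi ->
  adj (bigV K V phi) (dcls K xi) = dcls K (transport (isom_inv phi) xi).
Proof.
move=> lx; have [UU Ud] := bigV_unitary_dcls phi; have [_ UK _] := unitary_adj UU.
rewrite -[LHS](congr1 _ (congr1 (dcls K) (transportK phi xi))).
by rewrite -Ud ?UK//; exact: transport_L2.
Qed.

Lemma acts_as_conj phi (t : section F -> section F) (T : K -> K) :
  acts_as t T ->
  acts_as (transport phi \o t \o transport (isom_inv phi))
    (unitary_conj (bigV K V phi) T).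
Proof.
move=> [bT aT]; have [UU Ud] := bigV_unitary_dcls phi.
split; first exact: bounded_unitary_conj.
move=> xi lx; have [eta le [ae TE]] := aT _ (transport_L2 (isom_inv phi) lx).
exists (transport phi eta); first exact: transport_L2.
split; first exact: transport_ae.
by rewrite /unitary_conj /= bigV_adj_dcls// TE Ud.
Qed.

Lemma lift_op_conj phi (t : section F -> section F) :
  lift_op (transport phi \o t \o transport (isom_inv phi)) =
  unitary_conj (bigV K V phi) (lift_op t).
Proof.
have [UU _] := bigV_unitary_dcls phi.
have [[T aT]|none] := pselect (exists T : K -> K, acts_as t T).
  by rewrite (lift_opP aT); apply: lift_opP; exact: acts_as_conj.
rewrite (lift_op_none none) lift_op_none.
  by apply/funext => v; rewrite /unitary_conj /= (bounded_op_0 (bounded_unitary UU)).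
(* If the conjugate action were induced by an operator, conjugating back along the inverse isometry
   would give one for [t]. So both sides are the default 0. *)
move=> [T aT]; apply: none; exists (unitary_conj (bigV K V (isom_inv phi)) T).
have := acts_as_conj (isom_inv phi) aT; congr acts_as; apply/funext => xi /=.
by rewrite isom_invK !transport_invK.
Qed.

Lemma transport_fibrewise phi (T : opfield F) :
  transport phi \o (fun xi x => T x (xi x)) \o transport (isom_inv phi) =
  (fun xi x => unitary_conj (V _ _ (bis_to phi x)) (T (iinv phi x)) (xi x)).
Proof.
apply/funext => xi; apply: functional_extensionality_dep => x.
have [aU UK KU] := unitary_adj (rep_unitary V (bis_to phi x)).
rewrite /unitary_conj /= {1}/transport; congr (V _ _ (bis_to phi x) (T _ _)).
by rewrite -[LHS]UK -[in RHS](transportK phi xi).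
Qed.

Lemma decomposable_conj phi (T : opfield F) :
  decomposable (fun x => unitary_conj (V _ _ (bis_to phi x)) (T (iinv phi x))) =
  unitary_conj (bigV K V phi) (decomposable T).
Proof. by rewrite /decomposable -lift_op_conj transport_fibrewise. Qed.

Lemma decomposable_ae (S T : opfield F) : ae_op S T ->
  decomposable S = decomposable T :> (K -> K).
Proof. by move=> ST; apply: lift_op_ae => xi; apply: ae_vol_imply ST _ => x ->. Qed.

End DirectIntegral.

(** * Frames and relational fields *)

Section FrameTransport.
Variables (R : realType) (n : nat) (M : spacetime R n).
Local Notation mu := (vol M).
Variables (Q : qframe M) (pi : projections M) (phi : isom M).
Local Notation U := (qf_rep Q).

Lemma push_opE (w : opfield Q) (x : M) :
  @push_op _ _ _ _ U phi w x = unitary_conj (U _ _ (bis_to phi x)) (w (iinv phi x)).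
Proof. by []. Qed.

Lemma Ltrans_preimage_measurable (x : M) (D : set (borel_to x)) : measurable D ->
  measurable (Ltrans (bis_to phi x) @^-1` D : set (borel_to (iinv phi x))).
Proof. by move=> mD; rewrite -[X in measurable X]setTI; exact: Ltrans_bis_to_measurable. Qed.

Lemma povm_conj (x : M) (D : set (borel_to x)) : measurable D ->
  povm D = unitary_conj (U _ _ (bis_to phi x))
    (povm (Ltrans (bis_to phi x) @^-1` D : set (borel_to (iinv phi x)))).
Proof.
move=> mD; apply/funext => v.
rewrite /unitary_conj /= povm_cov; last exact: Ltrans_preimage_measurable.
congr (povm _ v); apply/seteqP; split => [c Dc|_ [c Dc <-]//].
by exists (Ltrans (bis (isom_inv phi) x) c); rewrite /= Ltrans_bis_invK.
Qed.

Lemma tr_push (w : opfield Q) (x : M) (D : set (borel_to x)) : measurable D ->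
  tr (@push_op _ _ _ _ U phi w x \o povm D) =
  tr (w (iinv phi x) \o
    povm (Ltrans (bis_to phi x) @^-1` D : set (borel_to (iinv phi x)))).
Proof.
move=> mD; rewrite (povm_conj mD) push_opE.
by rewrite -(unitary_conjM (rep_unitary U (bis_to phi x)))
  (tr_unitary_conj _ (rep_unitary U (bis_to phi x))).
Qed.

Definition has_law (x : M) (w : Q x -> Q x)
    (m : {measure set (borel_to x) -> \bar R}) :=
  forall D : set (borel_to x), measurable D ->
    exists2 r : R, m D = r%:E & tr (w \o povm D) = r%:C.

(** The trace determines the value on Borel sets only; the chosen [frame_measure] is pinned down
    there and nowhere else. *)
Lemma has_law_unique (x : M) (w : Q x -> Q x) m1 m2 (D : set (borel_to x)) :
  has_law w m1 -> has_law w m2 -> measurable D -> m1 D = m2 D.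
Proof.
move=> h1 h2 mD; have [r1 -> E1] := h1 D mD; have [r2 -> E2] := h2 D mD.
by move: E1; rewrite E2 => -[->].
Qed.

Lemma frame_measure_law (x : M) (w : Q x -> Q x) m :
  has_law w m -> has_law w (frame_measure w).
Proof.
move=> wm; rewrite /frame_measure /choose_or; case: pselect => [h|[]].
  by case: cid.
by exists m.
Qed.

(** Laws are carried in both directions by left translation. Either both states have one, and
    uniqueness applies, or both measures are the default zero measure. *)
Lemma frame_measure_push (w : opfield Q) (x : M) (D : set (borel_to x)) :
  measurable D ->
  frame_measure (@push_op _ _ _ _ U phi w x) D =
  frame_measure (w (iinv phi x)) (Ltrans (bis_to phi x) @^-1` D).
Proof.
move=> mD; pose b := bis_to phi x.
have mL := @Ltrans_bis_to_measurable _ _ _ phi x.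
have mL' := @Ltrans_bis_measurable _ _ _ (isom_inv phi) x.
have fwd m : has_law (w (iinv phi x)) m ->
    has_law (@push_op _ _ _ _ U phi w x) (image_measure m mL).
  move=> wm E mE; have [r mr tr_r] := wm _ (Ltrans_preimage_measurable mE).
  by exists r; [exact: mr|rewrite tr_push].
have bwd m : has_law (@push_op _ _ _ _ U phi w x) m ->
    has_law (w (iinv phi x)) (image_measure m mL').
  move=> wm E mE.
  have mE' : measurable (Ltrans (bis (isom_inv phi) x) @^-1` E : set (borel_to x)).
    by rewrite -[X in measurable X]setTI; exact: mL'.
  have [r mr tr_r] := wm _ mE'; exists r; first exact: mr.
  rewrite -tr_r tr_push// -comp_preimage.
  suff -> : Ltrans (bis (isom_inv phi) x) \o Ltrans (bis_to phi x) = id by [].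
  by apply/funext => c; exact: Ltrans_bis_toK.
have [[m wm]|none] := pselect (exists m, has_law (w (iinv phi x)) m).
  apply: (has_law_unique (m1 := frame_measure _) (m2 := image_measure _ mL) _ _ mD).
    exact: frame_measure_law (fwd _ wm).
  exact/fwd/frame_measure_law/wm.
rewrite /frame_measure /choose_or; case: pselect => [[m wm]|_].
  by exfalso; apply: none; exists (image_measure m mL'); exact: bwd.
by case: pselect => [h|_]; [case: none|rewrite /mzero].
Qed.

Section Fibre.
Variables (F : cfield M) (K : dintegral F) (V : urep F) (psi : opfield F).

Lemma rep_comp_fun x y z (b : arrow y z) (a : arrow x y) :
  V _ _ (acomp b a) = V _ _ b \o V _ _ a.
Proof. by apply/funext => v; rewrite rep_comp. Qed.

Let weak (x : M) (w : Q x -> Q x) (u v : F x) :=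
  cintegral (frame_measure w)
    (fun c => ip u (V _ _ (arr c) (psi (adj (V _ _ (arr c)) v)))).

(** Substitute [Ltrans (bis_to phi x) c] for the integration variable; functoriality of [V] then
    moves the bisection onto [u] and [v] as an adjoint. *)
Lemma weak_push (w : opfield Q) (x : M) (u v : F x) :
  weak (@push_op _ _ _ _ U phi w x) u v =
  weak (w (iinv phi x)) (adj (V _ _ (bis_to phi x)) u) (adj (V _ _ (bis_to phi x)) v).
Proof.
have Vb := rep_unitary V (bis_to phi x); have [aV _ _] := unitary_adj Vb.
rewrite /weak (cintegral_transfer (m1 := frame_measure (w (iinv phi x)))
  (@Ltrans_bis_to_measurable _ _ _ phi x)
  (@Ltrans_bis_measurable _ _ _ (isom_inv phi) x)
  (@Ltrans_bis_invK _ _ _ phi x) (@Ltrans_bis_toK _ _ _ phi x)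
  (@frame_measure_push w x)).
congr cintegral; apply/funext => c /=.
by rewrite rep_comp_fun adj_comp//=; try exact: rep_unitary; rewrite aV.
Qed.

Let fibre_spec (x : M) (w : Q x -> Q x) (T : F x -> F x) :=
  bounded_op T /\ forall u v, ip u (T v) = weak w u v.

Lemma fibre_spec_unique (x : M) (w : Q x -> Q x) (T : F x -> F x) :
  fibre_spec w T -> choose_or (fun _ => 0) (fibre_spec w) = T.
Proof.
move=> wT; apply: choose_or_unique => // T' [_ hT']; case: wT => [_ hT].
by apply/funext => v; apply: ip_inj => u; rewrite hT hT'.
Qed.

Lemma rel_fibre_push (w : opfield Q) (x : M) :
  @rel_fibre _ _ _ _ _ V (@psi) (@push_op _ _ _ _ U phi w) x =
  unitary_conj (V _ _ (bis_to phi x)) (@rel_fibre _ _ _ _ _ V (@psi) w (iinv phi x)).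
Proof.
have Vb := rep_unitary V (bis_to phi x); have [aV VK KV] := unitary_adj Vb.
have [[T wT]|none] := pselect (exists T, fibre_spec (w (iinv phi x)) T).
  rewrite [in RHS](_ : @rel_fibre _ _ _ _ _ V (@psi) w (iinv phi x) = T); last exact: fibre_spec_unique.
  apply: fibre_spec_unique; case: wT => bT hT.
  split; first exact: bounded_unitary_conj.
  by move=> u v; rewrite weak_push -hT /unitary_conj /= aV.
(* A weak integral at [x] would conjugate back to one at [iinv phi x]; without either, both fibres
   are the zero operator. *)
have none' : ~ exists T, fibre_spec (@push_op _ _ _ _ U phi w x) T.
  move=> [T [bT hT]]; apply: none.
  exists (unitary_conj (adj (V _ _ (bis_to phi x))) T); split.
    exact/bounded_unitary_conj/bT/unitary_adj_unitary.
  move=> u v; rewrite /unitary_conj /= adj_adj// -[u in LHS]VK.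
  have [_ iV _] := unitary_adj_unitary Vb.
  by rewrite iV hT weak_push !VK.
rewrite [LHS](_ : _ = fun _ => 0); last first.
  by rewrite /rel_fibre /choose_or; case: pselect => // h; case: none'.
rewrite (_ : @rel_fibre _ _ _ _ _ V (@psi) w (iinv phi x) = fun _ => 0); last first.
  by rewrite /rel_fibre /choose_or; case: pselect => // h; case: none.
by apply/funext => v; rewrite /unitary_conj /= (bounded_op_0 (bounded_unitary Vb)).
Qed.

Lemma rel_field_push (w : opfield Q) :
  rel_field V (@psi) (@push_op _ _ _ _ U phi w) =
  unitary_conj (bigV K V phi) (rel_field V (@psi) w : K -> K).
Proof.
rewrite /rel_field -decomposable_conj; congr decomposable.
by apply: functional_extensionality_dep => x; exact: rel_fibre_push.
Qed.

Lemma rel_field_ae (w w' : opfield Q) : ae_op w w' ->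
  rel_field V (@psi) w = rel_field V (@psi) w' :> (K -> K).
Proof.
move=> ww'; apply: decomposable_ae; apply: ae_vol_imply ww' _ => x e.
by rewrite /rel_fibre e.
Qed.

End Fibre.

Hypothesis pi_meas : proj_measurable pi.

Let pi_preimage_measurable (x : M) (A : set M) : open A ->
  measurable (@pi x @^-1` A : set (borel_to x)).
Proof.
move=> oA; rewrite -[X in measurable X]setTI; apply: pi_meas => //.
exact: open_measurable_borel.
Qed.

(** For open [A] the trace on [A] after the push is the trace on its preimage before it: by
    compatibility in the first case, and because both operators vanish in the second. Supports then
    correspond since [phi] is a homeomorphism. *)
Lemma supp_povmF_push (w : opfield Q) (x : M) :
  @pi (phi (iinv phi x)) \o Ltrans (bis phi (iinv phi x)) = phi \o @pi (iinv phi x) \/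
    w (iinv phi x) = (fun _ => 0) ->
  supp_povmF pi (@push_op _ _ _ _ U phi w x) = iinv phi @^-1` supp_povmF pi (w (iinv phi x)).
Proof.
have open_pre (f : M -> M) (A : set M) : continuous f -> open A -> open (f @^-1` A).
  by move=> cf oA; apply: open_comp.
move=> good.
have key (A : set M) : open A -> tr (@push_op _ _ _ _ U phi w x \o povmF pi A) =
    tr (w (iinv phi x) \o povmF pi (phi @^-1` A)).
  move=> oA; rewrite /povmF tr_push; last exact: pi_preimage_measurable.
  case: good => [compat|->]; last by [].
  have E : @pi x \o Ltrans (bis_to phi x) = phi \o @pi (iinv phi x).
    rewrite -compat.
    exact: (@bis_to_ind _ _ _ phi x (fun z a => @pi z \o Ltrans a =
      @pi (phi (iinv phi x)) \o Ltrans (bis phi (iinv phi x)))).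
  congr (tr (_ \o povm _)); apply/funext => c.
  by have /(congr1 (fun f => f c)) /= := E; rewrite /preimage /= => ->.
apply/seteqP; split => p /= Hp A oA Ap.
  have oA' := open_pre _ _ (@iinv_continuous _ _ _ phi) oA.
  have := Hp _ oA' Ap; rewrite (key _ oA').
  by rewrite -comp_preimage (_ : iinv phi \o phi = id)//;
    apply/funext => y; exact: ifunK.
rewrite key//; apply: Hp; first exact: open_pre _ _ (@isom_continuous _ _ _ phi) oA.
by rewrite /= iinvK.
Qed.

Lemma Loc_push (w : opfield Q) :
  (forall y, @pi (phi y) \o Ltrans (bis phi y) = phi \o @pi y \/ w y = (fun _ => 0)) ->
  Loc pi (@push_op _ _ _ _ U phi w) = phi @` Loc pi w.
Proof.
move=> good; apply/seteqP; split => [p [x _]|_ [p [x _ wp] <-]].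
  rewrite supp_povmF_push; last exact: good.
  by move=> /= wp; exists (iinv phi p); [exists (iinv phi x)|exact: iinvK].
exists (phi x) => //; rewrite supp_povmF_push; last exact: good.
by rewrite /= !ifunK.
Qed.

End FrameTransport.

(** * Generators of the local algebras and their transport *)

Section Generators.
Variables (R : realType) (n : nat) (M : spacetime R n).
Local Notation mu := (vol M).

(* [pi] is compatible with isometries only off a null set [N]. Annihilating the
   states there changes neither their class nor the relational fields, and can
   only shrink [Loc]. *)
Definition zero_on (F : cfield M) (N : set M) (w : opfield F) : opfield F :=
  fun x => if x \in N then fun _ => 0 else w x.

Lemma zero_on_ae (F : cfield M) (N : set (borel M)) (w : opfield F) :
  measurable N -> mu N = 0%E -> ae_op w (zero_on N w).
Proof.
move=> mN N0; exists N; split => // x /= nx; apply: contrapT => Nx; apply: nx.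
by rewrite /zero_on memNset.
Qed.

Lemma zero_on_state (F : cfield M) (N : set (borel M)) (w : opfield F) :
  measurable N -> mu N = 0%E -> state_field w -> state_field (zero_on N w).
Proof.
move=> mN N0 [[bw mw [c cw]] dw]; have ae := zero_on_ae w mN N0.
split; last by apply: ae_vol_imply2 ae dw _ => x <-.
split.
- by move=> x; rewrite /zero_on; case: ifP => _ //; exact: bounded_op0.
- move=> xi mxi eta ce; have [mRe mIm] := mw _ mxi _ ce.
  have mnN : measurable_fun setT (fun x : borel M => x \in N).
    apply: (measurable_fun_bool true); rewrite setTI.
    by rewrite (_ : _ @^-1` _ = N)//; apply/seteqP; split => x;
      [exact: set_mem|exact: mem_set].
  have ifN (f : borel M -> R) : measurable_fun setT f ->
      measurable_fun setT (fun x => if x \in N then 0 else f x).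
    exact: measurable_fun_ifT mnN (measurable_cst (0 : R)).
  by split; [have := ifN _ mRe|have := ifN _ mIm]; congr measurable_fun;
    apply/funext => x; rewrite /zero_on; case: ifP => // _; rewrite ip0r.
- by exists c; apply: ae_vol_imply2 ae cw _ => x <-.
Qed.

Section Localization.
Variables (Q : qframe M) (pi : projections M).

(** Either the zero operator has trace 0 and its support is empty, or the trace is constant on this
    fibre and the two supports coincide. *)
Lemma supp_povmF_zero (x : M) (w : Q x -> Q x) :
  supp_povmF pi (fun _ : Q x => 0) `<=` supp_povmF pi w.
Proof.
move=> p p0 A oA Ap; have := p0 A oA Ap.
rewrite [X in tr X](_ : _ = fun _ => 0)//.
have [->|E] := tr_zero (Q x); first by rewrite eqxx.
by rewrite (E (w \o povmF pi A)).
Qed.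

Lemma Loc_zero_sub (w w' : opfield Q) :
  (forall x, w' x = w x \/ w' x = (fun _ => 0)) -> Loc pi w' `<=` Loc pi w.
Proof.
move=> ww' p [x _ px]; exists x => //; move: px.
by have [->|->] := ww' x; [|exact: supp_povmF_zero].
Qed.

Definition generators (F : cfield M) (K : dintegral F) (V : urep F)
    (S : set (opfield Q)) (OS : set (opfield F)) (U : set M) : set (K -> K) :=
  [set T | exists phi w,
    [/\ OS phi, S w, Loc pi w `<=` U & T = rel_field V phi w]].

Arguments generators {F} K V S OS U.

(** Each state is first annihilated on the null set where compatibility may fail. This keeps its
    relational fields, and its localization region is then carried exactly to the image under
    [phi]. *)
Lemma generators_push (F : cfield M) (K : dintegral F) (V : urep F)
    (S : set (opfield Q)) (OS : set (opfield F)) (U : set M) (phi : isom M) :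
  proj_measurable pi -> isom_compatible pi -> subset_ae S (@state_field R n M Q) ->
  [set unitary_conj (bigV K V phi) T | T in generators K V S OS U] =
  generators K V (push_set (qf_rep Q) phi S) OS (phi @` U).
Proof.
move=> mpi [N [mN N0 sN]] [Sst Ssat].
pose good (w : opfield Q) := zero_on N w.
(* [S] is saturated for almost everywhere equality of states. *)
have goodS w : S w -> S (good w).
  by move=> Sw; apply: (Ssat w); [|exact/zero_on_state/Sst|exact: zero_on_ae].
have goodE psi w : rel_field V psi w = rel_field V psi (good w) :> (K -> K).
  by apply: rel_field_ae; exact: zero_on_ae.
have goodL w : Loc pi (push_op (qf_rep Q) phi (good w)) = phi @` Loc pi (good w).
  apply: Loc_push => // y; have [Ny|Ny] := pselect (N y).
    by right; rewrite /good /zero_on mem_set.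
  by left; apply: contrapT => nc; apply/Ny/sN => /(_ phi).
have good_sub w : Loc pi (good w) `<=` Loc pi w.
  by apply: Loc_zero_sub => x; rewrite /good /zero_on; case: ifP; [right|left].
apply/seteqP; split => [_ [_ [psi [w [OSpsi Sw wU ->]]] <-]|_ [psi [_ [OSpsi [w Sw <-] wU ->]]]].
- exists psi, (push_op (qf_rep Q) phi (good w)); split => //.
  + by exists (good w) => //; exact: goodS.
  + by rewrite goodL; apply: image_subset; exact: subset_trans wU.
  + by rewrite rel_field_push goodE.
- exists (rel_field V psi w); last by rewrite rel_field_push.
  exists psi, (good w); split => //; first exact: goodS.
  have : phi @` Loc pi (good w) `<=` phi @` U.
    (* At each point the push of the modified state is either the push of [w] or zero, so its
       localization is no larger. *)
    rewrite -goodL; apply: subset_trans wU; apply: Loc_zero_sub => x.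
    rewrite !push_opE /good /zero_on; case: ifP => _; [right|by left].
    apply/funext => v; rewrite /unitary_conj /=.
    exact/bounded_op_0/bounded_unitary/rep_unitary.
  move=> sub p wp; have [q Uq] := sub _ (ex_intro2 _ _ p wp erefl).
  by move/(congr1 (iinv phi)); rewrite !ifunK => <-.
Qed.

End Localization.

Lemma loc_spacelike_subset (sigma : R) (U U' W W' : set M) :
  U' `<=` U -> W' `<=` W -> loc_spacelike sigma U W -> loc_spacelike sigma U' W'.
Proof.
move=> UU' WW' [UW lt]; split => [p /UU'/UW h q /WW'/h//|].
apply: le_lt_trans lt; apply: ereal_sup_le => r [x [y [v [[Ux Wy C] e ->]]]].
by exists x, y, v; split => //; split => //; [exact: UU'|exact: WW'].
Qed.

End Generators.

(** * Commutants and the three properties of the net *)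

Lemma commutant_subset (R : realType) (H : hilbert R) (S T : set (H -> H)) :
  S `<=` T -> commutant T `<=` commutant S.
Proof. by move=> ST A [bA cA]; split => // B /ST; exact: cA. Qed.

(** Places the zero operator in every local algebra, so that 0 really occurs among the
    commutators. *)
Lemma commutant0 (R : realType) (H : hilbert R) (S : set (H -> H)) :
  (forall A, S A -> bounded_op A) -> commutant S (fun _ => 0).
Proof.
move=> bS; split; first exact: bounded_op0.
by move=> A /bS bA; apply/funext => v /=; rewrite (bounded_op_0 bA).
Qed.

Lemma bicommutant_commute (R : realType) (H : hilbert R) (S T : set (H -> H)) A B :
  (forall A', S A' -> bounded_op A') ->
  (forall A' B', S A' -> T B' -> A' \o B' = B' \o A') ->
  commutant (commutant S) A -> commutant (commutant T) B -> A \o B = B \o A.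
Proof.
move=> bS ST [_ cA] [bB cB]; apply/esym/cA; split => // A' SA'.
by apply: cB; split; [exact: bS|move=> B' TB'; rewrite (ST A')].
Qed.

Arguments generators {R n M Q} pi {F} K V S OS U.

Theorem theorem6p32 (R : realType) (n : nat) (M : spacetime R n)
    (HS : cfield M) (K : dintegral HS) (V : urep HS)
    (Q : qframe M)
    (pi : projections M) (pi_meas : proj_measurable pi)
    (pi_compat : isom_compatible pi)
    (SR : set (opfield Q)) (SR_sub : subset_ae SR (@state_field R n M Q))
    (SR_convex : convex_fields SR)
    (sigma : R) (sigma_ge0 : 0 <= sigma)
    (OS : set (opfield HS)) (OS_sub : subset_ae OS (@A_field R n M HS))
    (OS_adj : adj_closed OS)
    (OS_causal : causal_fields pi K V SR sigma OS) :
  [/\ forall U W : set M, U `<=` W ->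
        local_algebra pi K V SR OS U `<=` local_algebra pi K V SR OS W,
      forall (phi : isom M) (U : set M),
        [set bigV K V phi \o A \o adj (bigV K V phi)
          | A in local_algebra pi K V SR OS U]
        = local_algebra pi K V (push_set (qf_rep Q) phi SR) OS (phi @` U) &
      forall U W : set M, loc_spacelike sigma U W ->
        [set T | exists A B, [/\ local_algebra pi K V SR OS U A,
                                 local_algebra pi K V SR OS W B &
                                 T = commutator A B]]
        = [set (fun _ => 0)]].
Proof.
have gen_bounded (S : set (opfield Q)) U A : generators pi K V S OS U A -> bounded_op A.
  by move=> [psi [w [_ _ _ ->]]]; exact: lift_op_bounded.
split => [U W UW|phi U|U W UW].
- apply: commutant_subset; apply: commutant_subset.
  by move=> _ [psi [w [? ? wU ->]]]; exists psi, w; split => //; exact: subset_trans UW.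
- have [UU _] := bigV_unitary_dcls V K phi.
  rewrite /local_algebra -/(generators pi K V SR OS U).
  rewrite -/(generators pi K V (push_set (qf_rep Q) phi SR) OS (phi @` U)).
  rewrite -(generators_push K V OS U phi pi_meas pi_compat SR_sub).
  by rewrite -!(commutant_unitary_conj _ UU).
apply/seteqP; split => [_ [A [B [hA hB ->]]]|_ ->].
- apply/funext => v; rewrite /commutator; apply/eqP; rewrite subr_eq0; apply/eqP.
  have := bicommutant_commute (gen_bounded SR U) _ hA hB.
  move=> /(_ _)/(congr1 (fun f => f v)); apply.
  move=> _ _ [psi [w [OSpsi Sw wU ->]]] [psi' [w' [OSpsi' Sw' w'W ->]]].
  (* Separation passes from [U] and [W] to the localization regions inside them, where the causality
     hypothesis applies. *)
  have [comm _] := OS_causal _ _ _ _ OSpsi OSpsi' Sw Sw'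
    (loc_spacelike_subset wU w'W UW).
  apply/funext => u; apply/eqP; rewrite -subr_eq0; apply/eqP.
  exact: (congr1 (fun f => f u) comm).
- exists (fun _ => 0), (fun _ => 0); split.
  + by apply: commutant0 => A [].
  + by apply: commutant0 => A [].
  + by apply/funext => v; rewrite /commutator subrr.
Qed.
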